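(* Rooted Stars Subdigraph Isomorphism is fixed-parameter tractable with parameter $k$, i.e., it can be solved in time $g(k)\cdot |I|^{\mathcal{O}(1)}$ for some computable function $g$, where $|I|$ is the instance size.
   Context: For $\ell>0$, an $\ell$-star is an orientation of an undirected star with a center and $\ell$ leaves. Rooted Stars Subdigraph Isomorphism: the input is a host digraph $D$, a digraph $H$ formed by the disjoint union of $k$ stars $S_1,\dots,S_k$ with centers $C=\{s_1,\dots,s_k\}$, a set $X\subseteq V(D)$, and a mapping $f:C\to X$ (not necessarily bijective). The task is to find a subdigraph $H'\subseteq D$ with $H'\cong H$ such that for all $i\in[k]$ the vertex $f(s_i)$ is the center of a star $S_i'\subseteq D$ with $S_i'\cong S_i$, or to report that none exists. *)

(* Defs.v *)
From mathcomp Require Import all_boot.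

Set Implicit Arguments.
Unset Strict Implicit.
Unset Printing Implicit Defensive.

(** * Random access machines

    The RAM of Cook and Reckhow (1973): registers indexed by [nat] and holding
    natural numbers, a read-only input tape and a write-only output tape.
    Since the only arithmetic is addition and truncated subtraction, counting
    instructions (uniform cost) is polynomially related to Turing machine
    time, as long as the numbers on the input tape have polynomial length. *)

Inductive instr : Type :=
  | Const of nat & nat         (* Const i c   :  X_i <- c *)
  | Add of nat & nat & nat     (* Add i j k   :  X_i <- X_j + X_k *)
  | Sub of nat & nat & nat     (* Sub i j k   :  X_i <- X_j - X_k, truncated *)
  | LoadI of nat & nat         (* LoadI i j   :  X_i <- X_(X_j) *)
  | StoreI of nat & nat        (* StoreI i j  :  X_(X_i) <- X_j *)
  | Jpos of nat & nat          (* Jpos j l    :  goto l if X_j > 0 *)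
  | Read of nat                (* Read i      :  X_i <- next input number *)
  | Print of nat.              (* Print i     :  append X_i to the output *)

Definition program := seq instr.

Record config := Config {
  pc : nat;
  regs : nat -> nat;
  inp : seq nat;
  outp : seq nat
}.

Definition upd (X : nat -> nat) (i v : nat) : nat -> nat :=
  fun r => if r == i then v else X r.

(* [Read] at the end of the input yields 0; a machine whose program counter
   points outside the program has halted, and its configuration is final. *)
Definition step (P : program) (c : config) : config :=
  let: Config p X u w := c in
  match onth P p with
  | None => c
  | Some (Const i a) => Config p.+1 (upd X i a) u w
  | Some (Add i j k) => Config p.+1 (upd X i (X j + X k)) u w
  | Some (Sub i j k) => Config p.+1 (upd X i (X j - X k)) u w
  | Some (LoadI i j) => Config p.+1 (upd X i (X (X j))) u w
  | Some (StoreI i j) => Config p.+1 (upd X (X i) (X j)) u w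
  | Some (Jpos j l) => Config (if 0 < X j then l else p.+1) X u w
  | Some (Read i) => Config p.+1 (upd X i (head 0 u)) (behead u) w
  | Some (Print i) => Config p.+1 X u (rcons w (X i))
  end.

Definition init (x : seq nat) : config := Config 0 (fun=> 0) x [::].

(* On input [x], [P] halts after at most [t] steps with output [y]. *)
Definition runs_in (P : program) (x : seq nat) (t : nat) (y : seq nat) : Prop :=
  let c := iter t (step P) (init x) in
  onth P (pc c) = None /\ outp c = y.

Definition computable (g : nat -> nat) : Prop :=
  exists P : program, forall k : nat, exists t : nat,
    runs_in P [:: k] t [:: g k].

(** * Fixed-parameter tractability of search problems

    [enc] encodes instances as input tapes, [par] is the parameter, and
    [correct x y] says that [y] is an admissible output on [x]. *)

Definition fpt (I : Type) (enc : I -> seq nat) (par : I -> nat)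
    (correct : I -> seq nat -> Prop) : Prop :=
  exists (P : program) (g : nat -> nat) (c : nat),
    computable g /\
    forall x : I, exists (t : nat) (y : seq nat),
      [/\ runs_in P (enc x) t y,
          t <= g (par x) * size (enc x) ^ c
        & correct x y].

(** * Digraphs and stars *)

(* Digraphs whose vertices lie in [T]; opposite arcs and loops are allowed. *)
Record digraph (T : finType) := Digraph {
  verts : {set T};
  arcs : {set T * T};
  arcs_verts : forall u v, (u, v) \in arcs -> (u \in verts) && (v \in verts)
}.

Definition subdigraph (T : finType) (G G' : digraph T) : Prop :=
  verts G \subset verts G' /\ arcs G \subset arcs G'.

(* The values of [phi] outside [verts G] are irrelevant. *)
Definition is_iso (T T' : finType) (G : digraph T) (G' : digraph T')
    (phi : T -> T') : Prop :=
  [/\ {in verts G &, injective phi},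
      phi @: verts G = verts G'
    & {in verts G &, forall u v,
        ((phi u, phi v) \in arcs G') = ((u, v) \in arcs G)}].

Definition isomorphic (T T' : finType) (G : digraph T) (G' : digraph T') : Prop :=
  exists phi : T -> T', is_iso G G' phi.

(* Orientations of the undirected star with center [c] and [l] leaves. *)
Definition is_star (T : finType) (l : nat) (c : T) (S : digraph T) : Prop :=
  [/\ c \in verts S,
      #|verts S :\ c| = l,
      {in verts S :\ c, forall v, ((c, v) \in arcs S) (+) ((v, c) \in arcs S)}
    & forall u v, (u, v) \in arcs S -> (u == c) (+) (v == c)].

(* Isomorphism of stars as stars, i.e. preserving the center; this differs
   from isomorphism of digraphs only for stars with a single leaf. *)
Definition star_isomorphic (T T' : finType) (S : digraph T) (c : T)
    (S' : digraph T') (c' : T') : Prop :=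
  exists phi : T -> T', is_iso S S' phi /\ phi c = c'.

Definition is_disjoint_union (T : finType) (k : nat) (S : 'I_k -> digraph T)
    (G : digraph T) : Prop :=
  [/\ forall i j, i != j -> [disjoint verts (S i) & verts (S j)],
      verts G = \bigcup_i verts (S i)
    & arcs G = \bigcup_i arcs (S i)].

(** * Rooted Stars Subdigraph Isomorphism *)

(* The centers are pairwise distinct, so the map f : C -> X is represented by
   [root_of], with [root_of i] standing for f(s_i).  The host D is [host], H is
   [pat], S_i is [star i], s_i is [center i], X is [rootset], k is [nstars]. *)
Record instance := Instance {
  host_size : nat;
  host : digraph 'I_host_size;
  host_verts : verts host = setT;
  pat_size : nat;
  pat : digraph 'I_pat_size;
  pat_verts : verts pat = setT;
  nstars : nat;
  star : 'I_nstars -> digraph 'I_pat_size;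
  center : 'I_nstars -> 'I_pat_size;
  starP : forall i, exists2 l, 0 < l & is_star l (center i) (star i);
  pat_union : is_disjoint_union star pat;
  rootset : {set 'I_host_size};
  root_of : 'I_nstars -> 'I_host_size;
  root_of_in : forall i, root_of i \in rootset
}.

Arguments star : clear implicits.
Arguments center : clear implicits.
Arguments root_of : clear implicits.

(* The stars S_i' of a solution are its components. *)
Definition is_solution (x : instance) (H' : digraph 'I_(host_size x)) : Prop :=
  [/\ subdigraph H' (host x),
      isomorphic (pat x) H'
    & exists S' : 'I_(nstars x) -> digraph 'I_(host_size x),
        is_disjoint_union S' H' /\
        forall i, (exists2 l, 0 < l & is_star l (root_of x i) (S' i)) /\
                  star_isomorphic (star x i) (center x i) (S' i) (root_of x i)].

Arguments is_solution : clear implicits.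

(** ** Encodings *)

Definition set_code (p : nat) (A : {set 'I_p}) : seq nat :=
  [seq nat_of_bool (v \in A) | v <- enum 'I_p].

(* Adjacency matrix, row by row. *)
Definition arcs_code (p : nat) (G : digraph 'I_p) : seq nat :=
  [seq nat_of_bool ((u, v) \in arcs G) | u <- enum 'I_p, v <- enum 'I_p].

(* [star] is omitted: [star i] is the component of [pat] containing
   [center i].  Every number in the encoding is at most the length of the
   encoding, which is thus polynomially related to the size in bits. *)
Definition encode (x : instance) : seq nat :=
  [:: host_size x; pat_size x; nstars x]
    ++ arcs_code (host x) ++ arcs_code (pat x)
    ++ [seq nat_of_ord (center x i) | i <- enum 'I_(nstars x)]
    ++ set_code (rootset x)
    ++ [seq nat_of_ord (root_of x i) | i <- enum 'I_(nstars x)].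

(* Output 1 followed by a solution, or 0 if there is none. *)
Definition correct_output (x : instance) (y : seq nat) : Prop :=
  (exists H', is_solution x H' /\ y = 1 :: set_code (verts H') ++ arcs_code H')
  \/ (~ (exists H', is_solution x H') /\ y = [:: 0]).

(* Main.v *)
From mathcomp Require Import all_boot zify.
Require Import Defs.

Set Implicit Arguments.
Unset Strict Implicit.
Unset Printing Implicit Defensive.

(** Since the components of H' are the stars S_i', a solution is the same thing
    as an injection from the vertices of the pattern to those of the host that
    maps each center s_i to f(s_i) and each leaf of S_i to a neighbour of f(s_i)
    along an arc of the right direction.  All these are conditions on one
    vertex at a time, and injectivity keeps leaves off the roots, so this is a
    perfect matching problem in a bipartite graph, which the auction algorithm
    solves in polynomial time: an unmatched pattern vertex takes over the
    cheapest host vertex available to it, whose price goes up by one, and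
    failure is declared when that price has reached the number of host
    vertices.  The running time is thus bounded with g = 1.

    The machine is obtained by compiling a small language whose loops are all
    bounded by parameters of the instance, so that the cost of a command is
    bounded by a polynomial read off its syntax. *)

(** * Structured machine code *)

Definition mstate := ((nat -> nat) * seq nat * seq nat)%type.

Definition at_pc (p : nat) (s : mstate) : config := Config p s.1.1 s.1.2 s.2.

Definition is_jump (i : instr) : bool := if i is Jpos _ _ then true else false.

(** The instruction is run as a one-line program, so its action on registers and tapes need not be
    restated case by case; the program counter is dropped. *)
Definition effect (i : instr) (s : mstate) : mstate :=
  let c := step [:: i] (at_pc 0 s) in (regs c, inp c, outp c).

(* Register 0 is scratch: [Cond] and [While] set it to 1 to jump
   unconditionally. *)
Inductive code : Type :=
  | Nop
  | Atom of instr
  | Then of code & code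
  | Cond of nat & code & code
  | While of nat & code.

Notation "a ;; b" := (Then a b) (at level 61, right associativity).

Fixpoint clen (c : code) : nat :=
  match c with
  | Nop => 0
  | Atom _ => 1
  | Then a b => clen a + clen b
  | Cond _ a b => clen b + clen a + 3
  | While _ a => clen a + 5
  end.

(** Jump targets are absolute, hence the load address [p]. In [Cond] the else branch comes first,
    being what [Jpos] falls through to. *)
Fixpoint flat (p : nat) (c : code) : program :=
  match c with
  | Nop => [::]
  | Atom i => [:: i]
  | Then a b => flat p a ++ flat (p + clen a) b
  | Cond r a b =>
      [:: Jpos r (p + clen b + 3)] ++ flat (p + 1) b ++
      [:: Const 0 1; Jpos 0 (p + clen b + clen a + 3)] ++
      flat (p + clen b + 3) a
  | While r a =>
      [:: Jpos r (p + 3); Const 0 1; Jpos 0 (p + clen a + 5)] ++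
      flat (p + 3) a ++ [:: Const 0 1; Jpos 0 p]
  end.

Lemma size_flat c p : size (flat p c) = clen c.
Proof.
elim: c p => //= [a IHa b IHb|r a IHa b IHb|r a IHa] p;
  by rewrite ?size_cat /= ?size_cat /= ?IHa ?IHb; lia.
Qed.

(** * Time-bounded weakest preconditions *)

Definition runs_to (P : program) (b p : nat) (s : mstate) (p' : nat)
    (Q : mstate -> Prop) : Prop :=
  exists t s', [/\ t <= b, iter t (step P) (at_pc p s) = at_pc p' s' & Q s'].

(** Total correctness within [b] steps. Quantifying over the surrounding code makes the notion
    independent of where [c] is placed, so that the rules compose. *)
Definition wp (c : code) (b : nat) (Q : mstate -> Prop) (s : mstate) : Prop :=
  forall pre post : program,
    runs_to (pre ++ flat (size pre) c ++ post) b (size pre) s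
            (size pre + clen c) Q.

Lemma runs_to_trans P b1 b2 p s p1 p2 Q R :
  runs_to P b1 p s p1 Q ->
  (forall s', Q s' -> runs_to P b2 p1 s' p2 R) ->
  runs_to P (b1 + b2) p s p2 R.
Proof.
move=> [t1 [s1 [le1 E1 Q1]]] /(_ _ Q1) [t2 [s2 [le2 E2 R2]]].
exists (t2 + t1), s2; split=> //; first by lia.
by rewrite iterD E1.
Qed.

Lemma runs_to_sub P b b' p s p' (Q R : mstate -> Prop) :
  b <= b' -> (forall s', Q s' -> R s') ->
  runs_to P b p s p' Q -> runs_to P b' p s p' R.
Proof.
by move=> le QR [t [s' [le1 E /QR HR]]]; exists t, s'; split=> //; lia.
Qed.

Lemma runs_to_atom P p s i (Q : mstate -> Prop) :
  onth P p = Some i -> ~~ is_jump i -> Q (effect i s) ->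
  runs_to P 1 p s p.+1 Q.
Proof.
move=> Pp ij Qi; exists 1, (effect i s); split=> //=.
by case: i Pp ij {Qi} => //=; rewrite /step /at_pc /= => *;
   match goal with H : onth _ _ = _ |- _ => rewrite H end.
Qed.

Lemma runs_to_jump P p s r l (Q : mstate -> Prop) :
  onth P p = Some (Jpos r l) -> Q s ->
  runs_to P 1 p s (if 0 < s.1.1 r then l else p.+1) Q.
Proof. by move=> Pp Qs; exists 1, s; split=> //=; rewrite /step /at_pc /= Pp. Qed.

Lemma runs_to_refl P b p s (Q : mstate -> Prop) : Q s -> runs_to P b p s p Q.
Proof. by move=> Qs; exists 0, s. Qed.

Lemma onth_cat_size (pre s : program) i : onth (pre ++ s) (size pre + i) = onth s i.
Proof. by elim: pre. Qed.

Lemma runs_to_goto P p s l (Q : mstate -> Prop) :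
  onth P p = Some (Const 0 1) -> onth P p.+1 = Some (Jpos 0 l) ->
  Q (effect (Const 0 1) s) -> runs_to P 2 p s l Q.
Proof.
move=> P0 P1 Qs; apply: (@runs_to_trans _ 1 1 _ _ p.+1 _ (eq^~ (effect (Const 0 1) s))).
  exact: runs_to_atom P0 _ _.
by move=> _ ->; apply: (runs_to_jump P1 Qs).
Qed.

Lemma wp_runs_to c b Q s (P : program) p pre post :
  wp c b Q s -> size pre = p -> P = pre ++ flat p c ++ post ->
  runs_to P b p s (p + clen c) Q.
Proof. by move=> H <- ->; apply: H. Qed.

Lemma wp_sub c b b' Q R s :
  b <= b' -> (forall s', Q s' -> R s') -> wp c b Q s -> wp c b' R s.
Proof. by move=> le QR H pre post; apply: runs_to_sub le QR (H pre post). Qed.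

Lemma wp_nop (Q : mstate -> Prop) s : Q s -> wp Nop 0 Q s.
Proof. by move=> Qs pre post; rewrite /= addn0; apply: runs_to_refl. Qed.

Lemma wp_atom i (Q : mstate -> Prop) s :
  ~~ is_jump i -> Q (effect i s) -> wp (Atom i) 1 Q s.
Proof.
move=> ij Qs pre post; rewrite /= addn1; apply: runs_to_atom ij Qs.
by rewrite -[X in onth _ X]addn0 onth_cat_size.
Qed.

Lemma wp_then a b k l Q s :
  wp a k (wp b l Q) s -> wp (a ;; b) (k + l) Q s.
Proof.
move=> Ha pre post /=; rewrite -catA addnA.
apply: runs_to_trans (Ha _ _) _ => s' Hb.
apply: (wp_runs_to (pre := pre ++ flat (size pre) a) Hb).
  by rewrite size_cat size_flat.
by rewrite -!catA.
Qed.

(** Leaving the else branch requires a jump over the other one, which sets register 0 to 1; this is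
    the effect in the second premise. The 3 pays for the test and that jump. *)
Lemma wp_cond r a b k (Q : mstate -> Prop) s :
  (0 < s.1.1 r -> wp a k Q s) ->
  (s.1.1 r = 0 -> wp b k (fun s' => Q (effect (Const 0 1) s')) s) ->
  wp (Cond r a b) (k + 3) Q s.
Proof.
move=> Ha Hb pre post.
set p := size pre; set P := pre ++ _.
have P0 : onth P p = Some (Jpos r (p + clen b + 3)).
  by rewrite -[X in onth _ X]addn0 onth_cat_size.
have J := runs_to_jump (Q := eq^~ s) P0 erefl.
rewrite addnC -/(3 + k); case: posnP J => [r0|rp] J.
- have Rb : runs_to P k p.+1 s (p.+1 + clen b) (fun s' => Q (effect (Const 0 1) s')).
    apply: (wp_runs_to (pre := pre ++ [:: Jpos r (p + clen b + 3)]) (Hb r0)).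
      by rewrite size_cat addn1.
    by rewrite /P /= -?catA /= addn1 -?catA.
  apply: (@runs_to_sub _ (1 + (k + 2)) _ _ _ _ Q) => //; first by lia.
  apply: runs_to_trans J _ => _ ->; apply: runs_to_trans Rb _ => s' Qs'.
  have -> : p + clen (Cond r a b) = p + clen b + clen a + 3 by rewrite /=; lia.
  apply: runs_to_goto Qs'.
    have -> : p.+1 + clen b = p + (1 + clen b + 0) by lia.
    rewrite onth_cat_size /= -?catA /= -(size_flat b (p + 1)).
    by rewrite onth_cat_size.
  have -> : (p.+1 + clen b).+1 = p + (1 + (clen b + 1)) by lia.
  rewrite onth_cat_size /= -?catA /= -(size_flat b (p + 1)).
  by rewrite onth_cat_size.
- apply: (@runs_to_sub _ (1 + k) _ _ _ _ Q) => //; first by lia.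
  apply: runs_to_trans J _ => _ ->.
  have -> : p + clen (Cond r a b) = p + clen b + 3 + clen a by rewrite /=; lia.
  apply: (wp_runs_to (pre := pre ++ [:: Jpos r (p + clen b + 3)] ++ flat (p + 1) b ++
      [:: Const 0 1; Jpos 0 (p + clen b + clen a + 3)]) (Ha rp)).
    by rewrite !size_cat size_flat /=; lia.
  by rewrite /P /= -?catA /= -?catA.
Qed.

(** The invariant is indexed by the value of the counter register, so there are exactly [n] rounds,
    and it has to survive the overwriting of register 0. A round costs a test and a two-instruction
    jump besides the body, and so does the exit. *)
Lemma wp_while r a (J : nat -> mstate -> Prop) b n s :
  (forall i s, J i s -> s.1.1 r = i) ->
  (forall i s, J i s -> J i (effect (Const 0 1) s)) ->
  (forall i s, J i.+1 s -> wp a b (J i) s) ->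
  J n s -> wp (While r a) (n * (b + 3) + 3) (J 0) s.
Proof.
move=> Jr J0 Ja Jn pre post.
set p := size pre; set P := pre ++ _.
have P0 : onth P p = Some (Jpos r (p + 3)).
  by rewrite -[X in onth _ X]addn0 onth_cat_size.
have P1 : onth P p.+1 = Some (Const 0 1) by rewrite -addn1 onth_cat_size.
have P2 : onth P p.+2 = Some (Jpos 0 (p + clen a + 5)) by rewrite -addn2 onth_cat_size.
have P3 : onth P (p + 3 + clen a) = Some (Const 0 1).
  have -> : p + 3 + clen a = p + (3 + (clen a + 0)) by lia.
  by rewrite onth_cat_size /= -?catA /= -(size_flat a (p + 3)) onth_cat_size.
have P4 : onth P (p + 3 + clen a).+1 = Some (Jpos 0 p).
  have -> : (p + 3 + clen a).+1 = p + (3 + (clen a + 1)) by lia.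
  by rewrite onth_cat_size /= -?catA /= -(size_flat a (p + 3)) onth_cat_size.
elim: n s Jn => [|n IHn] s Jn.
- have Jp := runs_to_jump (Q := eq^~ s) P0 erefl.
  rewrite (Jr _ _ Jn) /= in Jp.
  rewrite mul0n; apply: (@runs_to_trans _ 1 2 _ _ p.+1) Jp _ => _ ->.
  rewrite /= addnA; apply: runs_to_goto P1 P2 _; exact: J0.
- have Jp := runs_to_jump (Q := eq^~ s) P0 erefl.
  rewrite (Jr _ _ Jn) /= in Jp.
  apply: (@runs_to_sub _ (1 + (b + (2 + (n * (b + 3) + 3)))) _ _ _ _ (J 0)) => //; first by lia.
  apply: runs_to_trans Jp _ => _ ->.
  apply: (@runs_to_trans _ _ _ _ _ (p + 3 + clen a) _ (J n)).
    apply: (wp_runs_to (pre := pre ++ [:: Jpos r (p + 3); Const 0 1; Jpos 0 (p + clen a + 5)])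
              (Ja _ _ Jn)).
      by rewrite size_cat.
    by rewrite /P /= -?catA /= -?catA.
  move=> s' Js'.
  apply: (@runs_to_trans _ 2 _ _ _ p _ (J n)); last by move=> s2 /IHn.
  by apply: runs_to_goto P3 P4 _; apply: J0.
Qed.
(** * A language of bounded loops *)

(* Stores map an array name and an index to a value.  Array 0 holds the
   parameters, which commands cannot write to and which bound all loops;
   array 1 holds the variables.  [Get], [Put] and [Inp] cannot address array 0:
   their first argument [a] stands for array [a.+1]. *)
Definition store := nat -> nat -> nat.

Definition set_cell (m : store) (a i v : nat) : store :=
  fun a' i' => if (a' == a) && (i' == i) then v else m a' i'.

Inductive expr : Type :=
  | Cst of nat
  | Par of nat
  | Plus of expr & expr
  | Minus of expr & expr
  | Get of nat & expr
  | IfE of expr & expr & expr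
  | SumE of nat & nat & expr.   (* SumE x j e  :  sum of e for x < Par j *)

Fixpoint eval (m : store) (e : expr) : nat :=
  match e with
  | Cst c => c
  | Par j => m 0 j
  | Plus a b => eval m a + eval m b
  | Minus a b => eval m a - eval m b
  | Get a e => m a.+1 (eval m e)
  | IfE e a b => if 0 < eval m e then eval m a else eval m b
  | SumE x j e => \sum_(i < m 0 j) eval (set_cell m 1 x i) e
  end.

Inductive cmd : Type :=
  | Skip
  | Put of nat & expr & expr
  | Inp of nat & expr
  | Out of expr
  | Seq of cmd & cmd
  | If of expr & cmd & cmd
  | For of nat & nat & cmd.     (* For x j c  :  for x < Par j do c *)

Definition state := (store * seq nat * seq nat)%type.

Definition set_var (s : state) (x v : nat) : state :=
  (set_cell s.1.1 1 x v, s.1.2, s.2).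

Fixpoint run (c : cmd) (s : state) : state :=
  match c with
  | Skip => s
  | Put a i e => (set_cell s.1.1 a.+1 (eval s.1.1 i) (eval s.1.1 e), s.1.2, s.2)
  | Inp a i =>
      (set_cell s.1.1 a.+1 (eval s.1.1 i) (head 0 s.1.2), behead s.1.2, s.2)
  | Out e => (s.1.1, s.1.2, rcons s.2 (eval s.1.1 e))
  | Seq c d => run d (run c s)
  | If e c d => if 0 < eval s.1.1 e then run c s else run d s
  | For x j c => iteri (s.1.1 0 j) (fun i s => run c (set_var s x i)) s
  end.

(** Every write goes to an array of positive index, so loop bounds stay fixed during a run. *)
Lemma run_par c s j : (run c s).1.1 0 j = s.1.1 0 j.
Proof.
elim: c s => //= [c IHc d IHd|e c IHc d IHd|x k c IHc] s.
- by rewrite IHd.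
- by case: ifP.
- by elim: (s.1.1 0 k) => //= n IHn; rewrite IHc.
Qed.

(** * Compilation *)

(* Array [a] lives in the registers [cellreg a.+1 i], temporaries in
   [cellreg 0 i]; register 0 is not of this form. *)
Definition cellreg (a i : nat) : nat := 2 ^ a * (i + i).+1.

Lemma cellreg_gt0 a i : 0 < cellreg a i.
Proof. by rewrite muln_gt0 expn_gt0. Qed.

(** A positive number is uniquely a power of two times an odd number; parity drives the induction on
    [a]. *)
Lemma cellreg_inj a i a' i' : (cellreg a i == cellreg a' i') = (a == a') && (i == i').
Proof.
rewrite /cellreg; elim: a a' => [|a IHa] [|a']; rewrite ?expn0 ?mul1n ?expnS -?mulnA.
- by lia.
- by set k := _ ^ _ * _; lia.
- by set k := _ ^ _ * _; lia.
- by rewrite eqn_pmul2l // IHa eqSS.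
Qed.

Lemma cellregS a i : cellreg a.+1 i = cellreg a i + cellreg a i.
Proof. by rewrite /cellreg expnS -mulnA mul2n -addnn. Qed.

Notation tmp := (cellreg 0).
Notation cell a := (cellreg a.+1).

(** Register 0 supplies the constant operand that [Add] and [Sub] cannot take directly. *)
Definition copy (r r' : nat) : code := Atom (Const 0 0) ;; Atom (Add r r' 0).
Definition incr (r : nat) : code := Atom (Const 0 1) ;; Atom (Add r r 0).
Definition decr (r : nat) : code := Atom (Const 0 1) ;; Atom (Sub r r 0).

(* Turns an index [i] in [tmp d] into [cellreg a i]. *)
Fixpoint address (d a : nat) : code :=
  match a with
  | 0 => Atom (Add (tmp d) (tmp d) (tmp d)) ;; incr (tmp d)
  | a.+1 => address d a ;; Atom (Add (tmp d) (tmp d) (tmp d))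
  end.

(** [tmp d] counts the remaining rounds down and [tmp d.+1] the finished ones up. The loop variable
    is reloaded in each round, so a body that overwrites it does not disturb the count. *)
Definition loop (d x j : nat) (body : code) : code :=
  copy (tmp d) (cell 0 j) ;;
  Atom (Const (tmp d.+1) 0) ;;
  While (tmp d) (copy (cell 1 x) (tmp d.+1) ;; incr (tmp d.+1) ;;
                 body ;; decr (tmp d)).

(** The value ends up in [tmp d]. For [SumE], [tmp d] accumulates, [tmp d.+1] saves the bound
    variable so that evaluation has no side effect on the store, and the loop owns the next two
    temporaries. *)
Fixpoint cexpr (e : expr) (d : nat) : code :=
  match e with
  | Cst c => Atom (Const (tmp d) c)
  | Par j => copy (tmp d) (cell 0 j)
  | Plus a b => cexpr a d ;; cexpr b d.+1 ;; Atom (Add (tmp d) (tmp d) (tmp d.+1))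
  | Minus a b => cexpr a d ;; cexpr b d.+1 ;; Atom (Sub (tmp d) (tmp d) (tmp d.+1))
  | Get a e => cexpr e d ;; address d a.+2 ;; Atom (LoadI (tmp d) (tmp d))
  | IfE e a b => cexpr e d ;; Cond (tmp d) (cexpr a d) (cexpr b d)
  | SumE x j e =>
      Atom (Const (tmp d) 0) ;;
      copy (tmp d.+1) (cell 1 x) ;;
      loop d.+2 x j
        (cexpr e d.+4 ;; Atom (Add (tmp d) (tmp d) (tmp d.+4))) ;;
      copy (cell 1 x) (tmp d.+1)
  end.

Fixpoint ccmd (c : cmd) (d : nat) : code :=
  match c with
  | Skip => Nop
  | Put a i e =>
      cexpr i d ;; address d a.+2 ;; cexpr e d.+1 ;;
      Atom (StoreI (tmp d) (tmp d.+1))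
  | Inp a i =>
      cexpr i d ;; address d a.+2 ;; Atom (Read (tmp d.+1)) ;;
      Atom (StoreI (tmp d) (tmp d.+1))
  | Out e => cexpr e d ;; Atom (Print (tmp d))
  | Seq c1 c2 => ccmd c1 d ;; ccmd c2 d
  | If e c1 c2 => cexpr e d ;; Cond (tmp d) (ccmd c1 d) (ccmd c2 d)
  | For x j c => loop d x j (ccmd c d.+2)
  end.

(** Per round: a copy, an increment and a decrement of 2 steps each, and 3 for [While]. Once: 3 to
    initialise and 3 to exit. *)
Definition loop_cost (n b : nat) : nat := n * (b + 9) + 6.

(** [P] gives the parameter values. Both branches of a conditional are charged, a sum being easier
    to bound than a maximum. *)
Fixpoint ecost (P : nat -> nat) (e : expr) : nat :=
  match e with
  | Cst _ => 1
  | Par _ => 2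
  | Plus a b | Minus a b => ecost P a + ecost P b + 1
  | Get a e => ecost P e + (a + 6)
  | IfE e a b => ecost P e + (ecost P a + ecost P b) + 3
  | SumE _ j e => loop_cost (P j) (ecost P e + 1) + 5
  end.

Fixpoint ccost (P : nat -> nat) (c : cmd) : nat :=
  match c with
  | Skip => 0
  | Put a i e => ecost P i + ecost P e + (a + 6)
  | Inp a i => ecost P i + (a + 7)
  | Out e => ecost P e + 1
  | Seq c d => ccost P c + ccost P d
  | If e c d => ecost P e + (ccost P c + ccost P d) + 3
  | For _ j c => loop_cost (P j) (ccost P c)
  end.

(** * Correctness of the compiler *)

Definition represents (X : nat -> nat) (m : store) : Prop :=
  forall a i, X (cell a i) = m a i.

Lemma updE X r v r' : upd X r v r' = if r' == r then v else X r'.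
Proof. by []. Qed.

Lemma cellreg_neq0 a i : (cellreg a i == 0) = false.
Proof. by apply/eqP => E; have := cellreg_gt0 a i; rewrite E. Qed.

Definition cellregE :=
  (updE, cellreg_inj, cellreg_neq0, eqxx, eqSS).

(* Code for expressions and commands at depth [d] leaves the temporaries
   below [d] alone. *)
Definition keeps (d : nat) (X X' : nat -> nat) : Prop :=
  forall i, i < d -> X' (tmp i) = X (tmp i).

Lemma wp_copy r r' (Q : mstate -> Prop) s : r' != 0 ->
  (forall X, X =1 upd (upd s.1.1 0 0) r (s.1.1 r') -> Q (X, s.1.2, s.2)) ->
  wp (copy r r') 2 Q s.
Proof.
move=> r'0 H; apply: (@wp_then _ _ 1 1); do 2!apply: wp_atom => //.
by apply: H => i /=; rewrite !updE /= (negPf r'0) addn0.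
Qed.

Lemma wp_incr r (Q : mstate -> Prop) s : r != 0 ->
  (forall X, X =1 upd (upd s.1.1 0 1) r (s.1.1 r).+1 -> Q (X, s.1.2, s.2)) ->
  wp (incr r) 2 Q s.
Proof.
move=> r0 H; apply: (@wp_then _ _ 1 1); do 2!apply: wp_atom => //.
by apply: H => i /=; rewrite !updE /= (negPf r0) addn1.
Qed.

Lemma wp_decr r (Q : mstate -> Prop) s : r != 0 ->
  (forall X, X =1 upd (upd s.1.1 0 1) r (s.1.1 r).-1 -> Q (X, s.1.2, s.2)) ->
  wp (decr r) 2 Q s.
Proof.
move=> r0 H; apply: (@wp_then _ _ 1 1); do 2!apply: wp_atom => //.
by apply: H => i /=; rewrite !updE /= (negPf r0) subn1.
Qed.

Lemma wp_address d a (Q : mstate -> Prop) s :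
  (forall X, (forall r, r != 0 -> r != tmp d -> X r = s.1.1 r) ->
     X (tmp d) = cellreg a (s.1.1 (tmp d)) -> Q (X, s.1.2, s.2)) ->
  wp (address d a) (a + 3) Q s.
Proof.
elim: a Q s => [|a IHa] Q s H /=.
  apply: (@wp_then _ _ 1 2); apply: wp_atom => //; apply: wp_incr.
    by rewrite cellreg_neq0.
  move=> X E; apply: H => [r r0 rd|]; rewrite E /= !cellregE.
    by rewrite (negPf r0) (negPf rd).
  by rewrite /cellreg expn0 !mul1n.
apply: (@wp_sub _ (a + 3 + 1) _ Q) => //; first by lia.
apply: wp_then; apply: IHa => X EX Ed; apply: wp_atom => //.
apply: H => [r r0 rd|] /=; rewrite !cellregE; first by rewrite (negPf rd) EX.
by rewrite Ed cellregS.
Qed.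

(** [J i] holds after [i] rounds. It may not depend on register 0 or on the two loop counters, which
    change between rounds. *)
Lemma wp_loop d x j body n b (J : nat -> mstate -> Prop) s :
  s.1.1 (cell 0 j) = n ->
  (forall i X Y u w, J i (X, u, w) ->
     (forall r, r != 0 -> r != tmp d -> r != tmp d.+1 -> Y r = X r) ->
     J i (Y, u, w)) ->
  (forall i X Y u w, i < n -> J i (X, u, w) ->
     (forall r, r != 0 -> r != tmp d -> r != tmp d.+1 -> Y r = upd X (cell 1 x) i r) ->
     wp body b (fun s' => [/\ J i.+1 s', s'.1.1 (tmp d) = Y (tmp d)
                           & s'.1.1 (tmp d.+1) = Y (tmp d.+1)]) (Y, u, w)) ->
  J 0 s ->
  wp (loop d x j body) (loop_cost n b) (J n) s.
Proof.
move=> En Jframe Jbody J0.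
(* Reindexes [J] by the number of rounds left, which is the value of [tmp d] that [wp_while]
   tracks. *)
pose K k (s : mstate) := [/\ k <= n, s.1.1 (tmp d) = k, s.1.1 (tmp d.+1) = n - k & J (n - k) s].
apply: (@wp_sub _ (2 + (1 + (n * (b + 6 + 3) + 3))) _ (K 0)).
- by rewrite /loop_cost; lia.
- by move=> s' [_ _ _]; rewrite subn0.
apply: wp_then; apply: wp_copy; first by rewrite cellreg_neq0.
move=> X EX; apply: wp_then; apply: wp_atom => //.
apply: wp_while => [k s' []||k|] //.
- move=> k [[Y u] w] [lek Yd Yd1 JY]; split=> //=; rewrite ?cellregE //.
  by apply: Jframe JY _ => r r0 *; rewrite /= updE (negPf r0).
- move=> [[Y u] w] [ltk Yd Yd1 JY].
  apply: (@wp_sub _ (2 + (2 + (b + 2))) _ (K k)) => //; first by lia.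
  rewrite /= in Yd Yd1.
  apply: wp_then; apply: wp_copy; first by rewrite cellreg_neq0.
  move=> Y1 E1; apply: wp_then; apply: wp_incr; first by rewrite cellreg_neq0.
  move=> Y2 E2; apply: wp_then; rewrite /= in E1 E2 *.
  apply: wp_sub (leqnn b) _ (Jbody (n - k.+1) _ _ _ _ _ JY _); first last.
  + move=> r r0 rd rd1.
    rewrite E2 updE (negPf rd1) updE (negPf r0) E1 !updE (negPf r0).
    by rewrite Yd1.
  + by lia.
  + move=> [[Z u'] w'] /= [JZ KZ KZ1]; apply: wp_decr; first by rewrite cellreg_neq0.
    have Zd : Z (tmp d) = k.+1.
      by rewrite KZ E2 !cellregE (ltn_eqF (ltnSn d)) /= E1 !cellregE.
    have Zd1 : Z (tmp d.+1) = n - k.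
      by rewrite KZ1 E2 !cellregE /= E1 !cellregE /= Yd1; lia.
    move=> Z' E; rewrite /= in E; split=> /=.
    * by lia.
    * by rewrite E !cellregE Zd.
    * by rewrite E !cellregE gtn_eqF //= Zd1.
    * have -> : n - k = (n - k.+1).+1 by lia.
      apply: Jframe JZ _ => r r0 rd rd1.
      by rewrite E !updE (negPf rd) (negPf r0).
- split=> //=; rewrite ?cellregE /= ?EX ?cellregE ?subnn //.
  + by rewrite ltn_eqF //= EX !cellregE.
  case: s En J0 EX => [[Y u] w] /= _ J0 EX.
  apply: Jframe J0 _ => r r0 rd rd1.
  by rewrite /= updE (negPf rd1) EX !updE (negPf r0) (negPf rd).
Qed.

Lemma wp_expr P e d m (s : mstate) (Q : mstate -> Prop) :
  m 0 =1 P -> represents s.1.1 m ->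
  (forall X, represents X m -> keeps d s.1.1 X -> X (tmp d) = eval m e ->
     Q (X, s.1.2, s.2)) ->
  wp (cexpr e d) (ecost P e) Q s.
Proof.
elim: e d m s Q => /= [c|j|e1 IH1 e2 IH2|e1 IH1 e2 IH2|a e IHe|e IHe e1 IH1 e2 IH2|x j e IHe]
  d m [[X u] w] Q mP R HQ; have {}R : represents X m by [].
- apply: wp_atom => //=; apply: HQ => [a i|i lt|] /=; rewrite !cellregE //=.
  by rewrite ltn_eqF.
- apply: wp_copy; first by rewrite cellreg_neq0.
  move=> Y EY; apply: HQ => [a i|i lt|]; rewrite EY !cellregE //=.
  by rewrite ltn_eqF.
- apply: (@wp_sub _ (ecost P e1 + (ecost P e2 + 1)) _ Q) => //; first by lia.
  apply: wp_then; apply: (IH1 _ m) => // Y RY KY EY.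
  apply: wp_then; apply: (IH2 _ m) => //= Z RZ KZ EZ.
  apply: wp_atom => //=; apply: HQ => [a i|i lt|] /=; rewrite !cellregE //=.
    by rewrite ltn_eqF // KZ ?KY //; lia.
  by rewrite EZ KZ ?EY.
- apply: (@wp_sub _ (ecost P e1 + (ecost P e2 + 1)) _ Q) => //; first by lia.
  apply: wp_then; apply: (IH1 _ m) => // Y RY KY EY.
  apply: wp_then; apply: (IH2 _ m) => //= Z RZ KZ EZ.
  apply: wp_atom => //=; apply: HQ => [a i|i lt|] /=; rewrite !cellregE //=.
    by rewrite ltn_eqF // KZ ?KY //; lia.
  by rewrite EZ KZ ?EY.
- apply: (@wp_sub _ (ecost P e + (a.+2 + 3 + 1)) _ Q) => //; first by lia.
  apply: wp_then; apply: (IHe _ m) => // Y RY KY EY.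
  apply: wp_then; apply: (@wp_address _ a.+2) => Z EZ EZd /=; apply: wp_atom => //=.
  apply: HQ => [a' i|i lt|] /=; rewrite !cellregE //=.
  + by rewrite EZ ?cellregE //= RY.
  + by rewrite ltn_eqF //= EZ ?cellregE //= ?KY ?ltn_eqF.
  + by rewrite EZd EZ ?cellregE //= EY RY.
- apply: (@wp_sub _ (ecost P e + (ecost P e1 + ecost P e2 + 3)) _ Q) => //; first by lia.
  apply: wp_then; apply: (IHe _ m) => // Y RY KY EY.
  apply: wp_cond; rewrite /= EY => Hc.
  + apply: (@wp_sub _ (ecost P e1) _ Q) => //; first by lia.
    apply: (IH1 _ m) => //= Z RZ KZ EZ; apply: HQ => // [i lt|]; first by rewrite KZ ?KY.
    by rewrite EZ Hc.
  + apply: (wp_sub (leq_addl _ _)); first by move=> s'; apply.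
    apply: (IH2 _ m) => //= Z RZ KZ EZ; apply: HQ => // [a i|i lt|] /=; rewrite !cellregE //.
      by rewrite KZ ?KY.
    by rewrite EZ Hc.
- apply: (@wp_sub _ (1 + (2 + (loop_cost (P j) (ecost P e + 1) + 2))) _ Q) => //; first by lia.
  apply: wp_then; apply: wp_atom => //; apply: wp_then; apply: wp_copy.
    by rewrite cellreg_neq0.
  move=> Y EY; rewrite /= in EY *; apply: wp_then.
  (* The cell of the bound variable is exempt from the representation; its old value sits in
     [tmp d.+1] until it is restored. *)
  pose J i (s : mstate) := [/\ s.1.2 = u, s.2 = w,
     forall a y, ~~ ((a == 1) && (y == x)) -> s.1.1 (cell a y) = m a y,
     keeps d X s.1.1 /\ s.1.1 (tmp d.+1) = m 1 x
     & s.1.1 (tmp d) = \sum_(k < i) eval (set_cell m 1 x k) e].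
  apply: (@wp_sub _ (loop_cost (P j) (ecost P e + 1)) _ (J (P j))) => //.
    move=> [[Z u'] w'] [/= -> -> Zm [ZX Zd1] Zd]; apply: wp_copy.
      by rewrite cellreg_neq0.
    move=> Z' EZ' /=; rewrite /= in EZ'; apply: HQ => [a i|i lt|]; rewrite EZ' !cellregE /=.
    + case: ifP => [/andP[/eqP-> /eqP->]|/negbT/Zm] //.
    + exact: ZX.
    + by rewrite Zd mP.
  apply: wp_loop.
  + by rewrite /= EY !cellregE /= R mP.
  + move=> i X1 Y1 _ _ [/= -> -> Xm [XX Xd1] Xd] E; split=> //= [a y ne||].
    * by rewrite E ?cellregE //= Xm.
    * split=> [y lt|]; rewrite E ?cellregE //=; try lia; exact: XX.
    * by rewrite E ?cellregE //=; lia.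
  + move=> i X0 X1 _ _ lti [/= -> -> Xm [XX Xd1] Xd] E.
    apply: wp_then; apply: (IHe _ (set_cell m 1 x i)) => [//|a y|Z RZ KZ EZ] /=.
      rewrite /set_cell E ?cellregE //=; case: ifP => // /negbT ne.
      exact: Xm.
    rewrite /= in KZ; apply: wp_atom => //=; split=> /=; rewrite ?cellregE /=.
    * split=> //= [a y ne||]; rewrite ?cellregE //=.
      - by rewrite RZ /set_cell (negPf ne).
      - split=> [y lt|]; rewrite ?cellregE /=.
          by rewrite ltn_eqF // KZ ?E ?cellregE ?XX //=; lia.
        by rewrite gtn_eqF // KZ ?E ?cellregE ?Xd1 //=; lia.
      - by rewrite big_ord_recr /= KZ ?EZ ?E ?cellregE ?Xd //; lia.
    * by rewrite gtn_eqF ?KZ //; lia.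
    * by rewrite gtn_eqF ?KZ //; lia.
  + split=> //= [a y ne||].
    * by rewrite EY !cellregE /= R.
    * by split=> [y lt|]; rewrite EY !cellregE //= ?R // !ltn_eqF //; lia.
    * by rewrite EY !cellregE /= ltn_eqF // big_ord0.
Qed.

Lemma wp_cmd P c d (s : mstate) (t : state) :
  t.1.1 0 =1 P -> represents s.1.1 t.1.1 -> s.1.2 = t.1.2 -> s.2 = t.2 ->
  wp (ccmd c d) (ccost P c)
     (fun s' => [/\ represents s'.1.1 (run c t).1.1, keeps d s.1.1 s'.1.1,
                    s'.1.2 = (run c t).1.2 & s'.2 = (run c t).2]) s.
Proof.
elim: c d s t => /= [|a i e|a i|e|c IHc c' IHc'|e c IHc c' IHc'|x j c IHc]
  d [[X u] w] [[m u'] w'] mP R /= <- <-; have {}R : represents X m by [].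
- by apply: wp_nop; split.
- apply: (@wp_sub _ (ecost P i + (a.+2 + 3 + (ecost P e + 1)))) (fun _ H => H) _; first by lia.
  apply: wp_then; apply: (wp_expr (m := m)) => // Y RY KY EY.
  apply: wp_then; apply: (@wp_address _ a.+2) => Z EZ EZd /=.
  apply: wp_then; apply: (wp_expr (m := m)) => // [a' i'|Z' RZ' KZ' EZ'] /=.
    by rewrite EZ ?cellregE //= RY.
  apply: wp_atom => //=; rewrite /= in EZd KZ' EZ'; split=> //= [a' i'|i' lt];
    rewrite KZ' // EZd EY !cellregE /=.
  + by rewrite EZ' /set_cell RZ'.
  + by rewrite KZ' ?EZ ?cellregE /= ?KY //; lia.
- apply: (@wp_sub _ (ecost P i + (a.+2 + 3 + (1 + 1)))) (fun _ H => H) _; first by lia.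
  apply: wp_then; apply: (wp_expr (m := m)) => // Y RY KY EY.
  apply: wp_then; apply: (@wp_address _ a.+2) => Z EZ EZd /=.
  apply: wp_then; apply: wp_atom => //; apply: wp_atom => //=.
  rewrite /= in EZd; split=> //= [a' i'|i' lt]; rewrite !cellregE /= (ltn_eqF (ltnSn d)) EZd EY !cellregE /=.
  + by rewrite /set_cell EZ ?cellregE //= RY.
  + by rewrite ltn_eqF ?EZ ?cellregE /= ?KY //; lia.
- apply: wp_then; apply: (wp_expr (m := m)) => // Y RY KY EY.
  by apply: wp_atom => //=; split=> //=; rewrite EY.
- apply: wp_then; apply: wp_sub (leqnn _) _ (IHc d _ (m, u, w) _ _ _ _) => //.
  move=> [[Y v] z] [RY KY Ev Ez]; rewrite /= in Ev Ez.
  apply: wp_sub (leqnn _) _ (IHc' d _ (run c (m, u, w)) _ _ _ _) => //.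
    move=> [[Z v'] z'] [RZ KZ Ev' Ez']; split=> // i lt.
    by rewrite /= in KZ KY *; rewrite KZ ?KY.
  by move=> k; rewrite run_par; apply: mP.
- apply: (@wp_sub _ (ecost P e + (ccost P c + ccost P c' + 3))) (fun _ H => H) _; first by lia.
  apply: wp_then; apply: (wp_expr (m := m)) => // Y RY KY EY.
  have KK Z : keeps d Y Z -> keeps d X Z by move=> KZ i lt; rewrite KZ ?KY.
  apply: wp_cond; rewrite /= EY => ->.
  + apply: wp_sub (leq_addr _ _) _ (IHc d _ (m, u, w) _ _ _ _) => //.
    by move=> [[Z v'] z'] [RZ KZ Ev' Ez']; split=> //; apply: KK.
  + apply: wp_sub (leq_addl _ _) _ (IHc' d _ (m, u, w) _ _ _ _) => //.
    move=> [[Z v'] z'] [RZ KZ Ev' Ez']; split=> //= [a i|i lt]; rewrite !cellregE //=.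
    exact: KK.
- pose S i := iteri i (fun i s => run c (set_var s x i)) (m, u, w).
  have Spar i k : (S i).1.1 0 k = m 0 k.
    by elim: i => //= i IHi; rewrite run_par.
  pose J i (s : mstate) := [/\ represents s.1.1 (S i).1.1, keeps d X s.1.1,
                              s.1.2 = (S i).1.2 & s.2 = (S i).2].
  rewrite -mP; apply: (wp_loop (J := J)).
  + by rewrite /= R.
  + move=> i X1 Y1 u1 w1 [/= RX KX -> ->] E; split=> //= [a y|y lt].
    * by rewrite E ?cellregE // RX.
    * by rewrite E ?cellregE //= ?KX //; lia.
  + move=> i X0 X1 u1 w1 lti [/= RX KX -> ->] E.
    apply: wp_sub (leqnn _) _ (IHc d.+2 _ (set_var (S i) x i) _ _ _ _) => //=.
    * move=> [[Z v'] z'] /= [RZ KZ -> ->]; split=> //=; try by apply: KZ; lia.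
      split=> // y lt /=; rewrite KZ ?E ?cellregE ?KX //; lia.
    * by move=> k; rewrite /set_cell /= Spar.
    * by move=> a y; rewrite E ?cellregE // /set_cell RX.
  + by split.
Qed.

(** * Polynomial bounds on the cost *)

(** For arguments above 1, a larger exponent absorbs constant factors and summands, so a bare power
    suffices. *)
Definition poly_bounded (f : nat -> nat) : Prop :=
  exists D, forall N, 1 < N -> f N <= N ^ D.

Lemma poly_bounded_const c : poly_bounded (fun=> c).
Proof.
exists c => N N1; apply: leq_trans (ltnW (ltn_expl c (isT : 1 < 2))) _.
by case: c => // c; rewrite leq_exp2r.
Qed.

Lemma poly_bounded_add f g :
  poly_bounded f -> poly_bounded g -> poly_bounded (fun N => f N + g N).
Proof.
move=> [a Ha] [b Hb]; exists (a + b).+1 => N N1.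
rewrite expnS -[X in X <= _]mul1n.
apply: leq_trans (_ : 2 * N ^ (a + b) <= _); last by rewrite leq_mul2r N1 orbT.
have N0 : 0 < N by apply: ltnW.
rewrite mul1n mul2n -addnn leq_add //.
  by apply: leq_trans (Ha _ N1) _; rewrite leq_pexp2l // leq_addr.
by apply: leq_trans (Hb _ N1) _; rewrite leq_pexp2l // leq_addl.
Qed.

Lemma poly_bounded_mul f g :
  poly_bounded f -> poly_bounded g -> poly_bounded (fun N => f N * g N).
Proof.
move=> [a Ha] [b Hb]; exists (a + b) => N N1.
by rewrite expnD leq_mul ?Ha ?Hb.
Qed.

Lemma poly_bounded_id : poly_bounded id.
Proof. by exists 1 => N _; rewrite expn1. Qed.

Lemma poly_bounded_loop f :
  poly_bounded f -> poly_bounded (fun N => loop_cost N (f N)).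
Proof.
move=> Hf; rewrite /loop_cost.
apply: poly_bounded_add (poly_bounded_const 6); apply: poly_bounded_mul poly_bounded_id _.
exact: poly_bounded_add Hf (poly_bounded_const 9).
Qed.

#[local] Hint Resolve poly_bounded_const poly_bounded_add poly_bounded_loop : core.

Lemma poly_bounded_ecost e : poly_bounded (fun N => ecost (fun=> N) e).
Proof. by elim: e => /= *; auto 10. Qed.

#[local] Hint Resolve poly_bounded_ecost : core.

Lemma poly_bounded_ccost c : poly_bounded (fun N => ccost (fun=> N) c).
Proof. by elim: c => /= *; auto 10. Qed.

Lemma leq_loop_cost n n' b b' :
  n <= n' -> b <= b' -> loop_cost n b <= loop_cost n' b'.
Proof. by move=> *; rewrite leq_add2r leq_mul // leq_add2r. Qed.

(** Costs are monotone in the parameters, so all of these may be replaced by one common bound. *)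
Lemma leq_ecost P N e : (forall j, P j <= N) -> ecost P e <= ecost (fun=> N) e.
Proof.
by move=> PN; elim: e => //= *; do ?[exact: leqnn | apply: leq_loop_cost | apply: leq_add].
Qed.

Lemma leq_ccost P N c : (forall j, P j <= N) -> ccost P c <= ccost (fun=> N) c.
Proof.
by move=> PN; elim: c => //= *;
  do ?[exact: leqnn | exact: leq_ecost | apply: leq_loop_cost | apply: leq_add].
Qed.

(* n + 1 bounds both of the nested loops of [bids], and 1 serves to read
   one-dimensional arrays as matrices with one column. *)
Definition params (n p k : nat) : store :=
  fun a i => if a == 0 then nth 0 [:: n; p; k; n.+1; 1] i else 0.

(** Commands cannot write to array 0, so the parameters are loaded by hand-written code. *)
Definition prelude : code :=
  Atom (Read (cell 0 0)) ;; Atom (Read (cell 0 1)) ;; Atom (Read (cell 0 2)) ;;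
  copy (cell 0 3) (cell 0 0) ;; incr (cell 0 3) ;; Atom (Const (cell 0 4) 1).

Lemma wp_prelude n p k u :
  wp prelude 8 (fun s => [/\ represents s.1.1 (params n p k), s.1.2 = u & s.2 = [::]])
     (fun=> 0, [:: n, p, k & u], [::]).
Proof.
do 3![apply: (@wp_then _ _ 1); apply: wp_atom => //].
apply: (@wp_then _ _ 2 3); apply: wp_copy; first by rewrite cellreg_neq0.
move=> X EX; apply: (@wp_then _ _ 2 1); apply: wp_incr; first by rewrite cellreg_neq0.
move=> Y EY; apply: wp_atom => //=; split=> // a i /=.
rewrite /= in EX EY; rewrite updE EY updE updE !EX !cellregE /params.
by case: a => [|a]; case: i => [|[|[|[|[|i]]]]] //=; rewrite nth_nil.
Qed.

(** Program and exponent depend on [c] alone. Strictness in [n < N] is there for the parameter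
    [n.+1]. *)
Theorem run_cmd_poly (c : cmd) :
  exists P D, forall n p k u N,
    1 < N -> n < N -> p < N -> k < N ->
    exists2 t, t <= N ^ D
      & runs_in P [:: n, p, k & u] t (run c (params n p k, u, [::])).2.
Proof.
have [D HD] := poly_bounded_add (poly_bounded_const 8) (poly_bounded_ccost c).
exists (flat 0 (prelude ;; ccmd c 0)), D => n p k u N N1 nN pN kN.
pose s0 : mstate := (fun=> 0, [:: n, p, k & u], [::]).
have : wp (prelude ;; ccmd c 0) (8 + ccost (params n p k 0) c)
    (fun s => s.2 = (run c (params n p k, u, [::])).2) s0.
  apply: wp_then; apply: wp_sub (wp_prelude n p k u) => // s [Rs Eu Ew].
  by apply: wp_sub (wp_cmd (t := (params n p k, u, [::])) c 0 _ Rs Eu Ew) => // s' [].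
case/(_ [::] [::]) => t [s' [tb E Es']]; exists t.
  apply: leq_trans (leq_trans tb _) (HD _ N1); rewrite leq_add2l.
  by apply: leq_ccost => -[|[|[|[|[|j]]]]]; rewrite /params /= ?nth_nil //; apply: ltnW.
rewrite cat0s cats0 add0n in E; rewrite /runs_in /init.
rewrite -/(at_pc 0 s0) E; split=> //.
(* The program counter has reached the length of the program, so the machine has halted. *)
by rewrite onth_default // size_flat.
Qed.

(** * Bipartite matching by auction *)

Section Auction.

Variables (p n : nat) (adj : nat -> nat -> bool).

(* [own v = w.+1] if [v] is matched with [w], [own v = 0] if [v] is free;
   [cur = w.+1] if [w] is about to bid. *)
Record auction (q : nat) (own price : nat -> nat) (cur : nat) : Prop := Auction {
  auction_cur : cur <= q;
  auction_own : forall v, v < n -> own v <= q;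
  auction_price : forall v, v < n -> price v <= n;
  auction_adj : forall v w, v < n -> own v = w.+1 -> adj w v;
  auction_inj : forall v v', v < n -> v' < n -> 0 < own v -> own v = own v' -> v = v';
  auction_cur_free : forall v, v < n -> 0 < cur -> own v <> cur;
  auction_free : forall v, v < n -> own v = 0 -> price v = 0;
  auction_slack : forall v v' w, v < n -> v' < n ->
    own v = w.+1 -> adj w v' -> price v <= (price v').+1
}.

Lemma eq_auction q own own' price price' cur :
  own =1 own' -> price =1 price' -> auction q own price cur -> auction q own' price' cur.
Proof.
move=> Eo Ep [A1 A2 A3 A4 A5 A6 A7 A8].
split=> // [v|v|v w|v v'|v|v|v v' w]; rewrite -?Eo -?Ep //; eauto.
Qed.

(** The newcomer [q], labelled [q.+1], owns nothing because all labels so far are at most [q]. *)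
Lemma auction_next q own price : auction q own price 0 -> auction q.+1 own price q.+1.
Proof.
move=> [A1 A2 A3 A4 A5 A6 A7 A8]; split=> // v vn; first exact/leqW/A2.
by move=> _ E; have := A2 v vn; rewrite E ltnn.
Qed.

Lemma auction_drop q own price cur : auction q own price cur -> auction q own price 0.
Proof. by move=> [A1 A2 A3 A4 A5 A6 A7 A8]; split. Qed.

(** The previous owner of [v], if any, becomes the bidder. Slack holds for the new owner because it
    took a cheapest neighbour, and a higher price of [v] only relaxes the condition for the
    others. *)
Lemma auction_bid q own price w v :
  auction q own price w.+1 -> v < n -> adj w v -> price v < n ->
  (forall v', v' < n -> adj w v' -> price v <= price v') ->
  auction q (upd own v w.+1) (upd price v (price v).+1) (own v).
Proof.
move=> [A1 A2 A3 A4 A5 A6 A7 A8] vn wv pv min; split.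
- exact: A2.
- by move=> u un; rewrite updE; case: eqP => // _; apply: A2.
- by move=> u un; rewrite updE; case: eqP => // _; apply: A3.
- move=> u w' un; rewrite updE; case: eqP => [-> [<-] //|_]; exact: A4.
- move=> u u' un un'; rewrite !updE; case: eqP => [->|_]; case: eqP => [->|_] //.
  + by move=> _ E; case: (A6 u').
  + by move=> _ E; case: (A6 u).
  + exact: A5.
- move=> u un ov; rewrite updE; case: eqP => [uv E|ne E].
    by case: (A6 v) => //; rewrite E.
  by apply/ne/A5; rewrite // E.
- by move=> u un; rewrite !updE; case: eqP => // _; apply: A7.
- move=> u u' w' un un'; rewrite !updE; case: eqP => [_|_] E a.
    by case: E a => <- a; case: eqP => // _; rewrite ltnS min.
  case: eqP a => [->|_] a; last exact: A8 E a.
  by apply: leqW; apply: A8 E a.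
Qed.

(* The vertices of price at least t + 1 are all matched, and [w] together with
   their partners has all its neighbours among the vertices of price at least
   t.  In a perfect matching, these vertices would therefore get strictly more
   numerous at each step down from price n + 1. *)
Lemma auction_fail q own price w :
  q <= p -> auction q own price w.+1 ->
  (forall v, v < n -> adj w v -> n <= price v) ->
  ~ exists2 phi : 'I_p -> 'I_n, injective phi & forall w : 'I_p, adj w (phi w).
Proof.
move=> qp [/leq_trans/(_ qp) A1 A2 A3 A4 A5 A6 A7 A8] high [phi phi_inj phi_adj].
pose V t := [set v : 'I_n | t <= price v].
suff bound t : t <= n.+1 -> #|V t| + t <= n.
  by have := bound n.+1 (leqnn _); lia.
elim: t => [_|t IHt tn]; first by rewrite addn0 -[X in _ <= X]card_ord max_card.
suff : #|V t.+1| < #|V t| by have := IHt (ltnW tn); lia.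
(* The partner of [v]. The default of [insubd] is never reached on [V t.+1], as [oE] shows: vertices
   of positive price are owned. *)
pose o (v : 'I_n) : 'I_p := insubd (Ordinal A1) (own v).-1.
have oE v : v \in V t.+1 -> own v = (o v).+1.
  rewrite inE => pv; have ov : 0 < own v.
    by case: (posnP (own v)) => // /A7 E; rewrite E in pv.
  rewrite val_insubd prednK // ; case: ifP => [|/negP[]]; first by rewrite prednK.
  exact: leq_trans (A2 _ (ltn_ord v)) qp.
have wo : Ordinal A1 \notin [set o v | v in V t.+1].
  apply/imsetP => -[v /oE ov E]; case: (A6 v) => //.
  by rewrite ov -E.
(* The bidder and the partners of [V t.+1] are one more than [V t.+1] has elements; it remains to
   see that [phi] sends them into [V t]. *)
have <- : #|Ordinal A1 |: [set o v | v in V t.+1]| = #|V t.+1|.+1.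
  rewrite cardsU1 wo add1n card_in_imset // => v v' /oE E /oE E' ovv'.
  by apply: val_inj; apply: (A5 _ _ (ltn_ord v) (ltn_ord v')); rewrite ?E ?E' ?ovv'.
rewrite -(card_imset _ phi_inj); apply/subset_leq_card/subsetP => u /imsetP[w' + ->].
case/setU1P => [->|/imsetP[v Vv ->]]; rewrite inE.
  exact: leq_trans (tn : t <= n) (high _ (ltn_ord _) (phi_adj (Ordinal A1))).
have := A8 _ _ _ (ltn_ord v) (ltn_ord _) (oE _ Vv) (phi_adj (o v)).
by rewrite inE in Vv; move=> /(leq_trans Vv).
Qed.

(** The equivalence makes [own] the inverse of [phi], which is the form in which the program prints
    the solution. *)
Lemma auction_done q own price cur :
  auction q own price cur ->
  (forall w, w < p -> exists2 v, v < n & own v = w.+1) ->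
  exists2 phi : 'I_p -> 'I_n,
    forall (w : 'I_p) (v : 'I_n), (own v == w.+1) = (v == phi w)
    & forall w : 'I_p, adj w (phi w).
Proof.
move=> A all_matched.
have ex (w : 'I_p) : exists v : 'I_n, own v == w.+1.
  by have [v vn E] := all_matched w (ltn_ord w); exists (Ordinal vn); apply/eqP.
exists (fun w => xchoose (ex w)) => w; last first.
  exact/(auction_adj A)/eqP/(xchooseP (ex w)).
move=> v; apply/eqP/eqP => [E|->]; last exact/eqP/(xchooseP (ex w)).
have /eqP E' := xchooseP (ex w).
have ov : 0 < own v by rewrite E.
apply: val_inj; apply: (auction_inj A (ltn_ord v) (ltn_ord _) ov).
by rewrite E E'.
Qed.

End Auction.

(** * Solutions as compatible injections *)

(** Every arc of a star joins its center to a leaf, and centers are forced onto their roots, so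
    preservation of arcs becomes a condition on single vertices. *)
Definition compatible (x : instance) (w : 'I_(pat_size x)) (v : 'I_(host_size x)) : bool :=
  [forall i : 'I_(nstars x),
    [&& (w == center x i) ==> (v == root_of x i),
        ((center x i, w) \in arcs (pat x)) ==> ((root_of x i, v) \in arcs (host x))
      & ((w, center x i) \in arcs (pat x)) ==> ((v, root_of x i) \in arcs (host x))]].

(** * Images of digraphs under injections *)

Lemma image_digraph_subproof (T T' : finType) (phi : T -> T') (G : digraph T) u v :
  (u, v) \in [set (phi a.1, phi a.2) | a in arcs G] ->
  (u \in phi @: verts G) && (v \in phi @: verts G).
Proof.
case/imsetP => -[a b] /arcs_verts/andP[aG bG] [-> ->].
by rewrite !imset_f.
Qed.

Definition image_digraph (T T' : finType) (phi : T -> T') (G : digraph T) : digraph T' :=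
  Digraph (@image_digraph_subproof T T' phi G).

Section Image.

Variables (T T' : finType) (phi : T -> T').
Hypothesis phi_inj : injective phi.

Lemma image_arc (G : digraph T) u v :
  ((phi u, phi v) \in arcs (image_digraph phi G)) = ((u, v) \in arcs G).
Proof.
apply/imsetP/idP => [[[a b] ab [/phi_inj -> /phi_inj ->]] //|uv].
by exists (u, v).
Qed.

Lemma image_is_iso (G : digraph T) : is_iso G (image_digraph phi G) phi.
Proof.
split=> // [u v _ _ /phi_inj //|u v _ _]; exact: image_arc.
Qed.

Lemma image_is_star l c (S : digraph T) :
  is_star l c S -> is_star l (phi c) (image_digraph phi S).
Proof.
move=> [cS lS arcS starS].
have E : phi @: verts S :\ phi c = phi @: (verts S :\ c).
  apply/setP => y; rewrite !inE; apply/andP/imsetP => [[yc /imsetP[w wS yE]]|[w]].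
    by exists w; rewrite // !inE wS andbT -(inj_eq phi_inj) -yE.
  by rewrite !inE => /andP[wc wS] ->; rewrite (inj_eq phi_inj) wc imset_f.
split=> [||v|u v].
- exact: imset_f.
- by rewrite /= E card_imset.
- by rewrite /= E => /imsetP[w wS ->]; rewrite !image_arc arcS.
- by case/imsetP => -[a b] /starS /= ab [-> ->]; rewrite !(inj_eq phi_inj).
Qed.

Lemma image_disjoint_union k (S : 'I_k -> digraph T) (G : digraph T) :
  is_disjoint_union S G ->
  is_disjoint_union (fun i => image_digraph phi (S i)) (image_digraph phi G).
Proof.
move=> [dis vE aE]; split=> [i j /dis ij||] /=.
- by rewrite imset_disjoint // => ? ? _ _ /phi_inj.
- by rewrite vE; apply: (big_morph (fun A : {set T} => phi @: A)); [exact: imsetU | exact: imset0].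
- rewrite aE; apply: (big_morph (fun A : {set T * T} => [set (phi a.1, phi a.2) | a in A])).
    exact: imsetU.
  exact: imset0.
Qed.

End Image.

Lemma compatible_is_solution (x : instance) (phi : 'I_(pat_size x) -> 'I_(host_size x)) :
  injective phi -> (forall w, compatible w (phi w)) ->
  is_solution x (image_digraph phi (pat x)).
Proof.
move=> phi_inj phiC.
have rootE i : phi (center x i) = root_of x i.
  by have /forallP/(_ i)/andP[] := phiC (center x i); rewrite eqxx => /eqP.
split.
- split; first by rewrite host_verts subsetT.
  apply/subsetP => _ /imsetP[[a b] ab ->] /=.
  have [_ _ arcsE] := pat_union x.
  move: (ab); rewrite arcsE => /bigcupP[i _ abi].
  (* Exactly one end of the arc is the center of its star; compatibility of the other end provides
     the arc of the host. *)
  have [l _ [_ _ _ /(_ _ _ abi)]] := starP i.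
  have [Ea _|_ /= /eqP Eb] := eqVneq a (center x i).
    have /forallP/(_ i)/and3P[_ /implyP + _] := phiC b.
    by rewrite -rootE -Ea; apply.
  have /forallP/(_ i)/and3P[_ _ /implyP] := phiC a.
  by rewrite -rootE -Eb; apply.
- by exists phi; apply: image_is_iso.
- exists (fun i => image_digraph phi (star x i)); split.
    exact/image_disjoint_union/pat_union.
  move=> i; split.
    by have [l l0 Sl] := starP i; exists l => //; rewrite -rootE; apply: image_is_star.
  by exists phi; split=> //; apply: image_is_iso.
Qed.

(** The center-preserving isomorphisms between the stars are glued along the partition of the
    pattern. Disjointness of the stars in the host makes the result injective. *)
Lemma solution_compatible (x : instance) (H' : digraph 'I_(host_size x)) :
  is_solution x H' ->
  exists2 phi : 'I_(pat_size x) -> 'I_(host_size x),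
    injective phi & forall w, compatible w (phi w).
Proof.
move=> [[_ /subsetP H'host] _ [S' [[dis' _ arcs'] sol]]].
have [dis vertsE arcsE] := pat_union x.
have ex_star w : exists i, w \in verts (star x i).
  have : w \in verts (pat x) by rewrite pat_verts.
  by rewrite vertsE => /bigcupP[i _ wi]; exists i.
have [of_star starE] := fin_all_exists ex_star.
have [psi psiE] := fin_all_exists (fun i => (sol i).2).
pose phi w := psi (of_star w) w.
have phi_in w : phi w \in verts (S' (of_star w)).
  by have [[_ <- _] _] := psiE (of_star w); apply: imset_f.
have of_starE w i : w \in verts (star x i) -> of_star w = i.
  move=> wi; apply/eqP/negPn/negP => ne.
  by have /pred0P/(_ w) := dis _ _ ne; rewrite /= starE wi.
have phi_arc a b : (a, b) \in arcs (pat x) -> (phi a, phi b) \in arcs (host x).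
  rewrite arcsE => /bigcupP[j _ ab]; apply: H'host.
  have /andP[aj bj] := arcs_verts ab.
  rewrite arcs'; apply/bigcupP; exists j => //.
  have [[_ _ /(_ a b aj bj) arcE] _] := psiE j.
  by rewrite /phi (of_starE _ _ aj) (of_starE _ _ bj) arcE.
have phi_center i : phi (center x i) = root_of x i.
  have [l _ [ci _ _ _]] := starP i.
  by rewrite /phi (of_starE _ _ ci); have [_ E] := psiE i.
exists phi => [a b E|w].
  have E' : of_star a = of_star b.
    apply/eqP/negPn/negP => /dis'/disjointFr/(_ (phi_in a)).
    by rewrite E phi_in.
  have [[inj _ _] _] := psiE (of_star a).
  apply: inj; [exact: starE | by rewrite E' starE | by move: E; rewrite /phi E'].
apply/forallP => i; apply/and3P; split; apply/implyP.
- by move/eqP->; rewrite phi_center.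
- by rewrite -phi_center; apply: phi_arc.
- by rewrite -phi_center; apply: phi_arc.
Qed.

(** * The program *)

Lemma run_Seq c d s : run (Seq c d) s = run d (run c s).
Proof. by []. Qed.

Lemma run_For_ind (I : nat -> state -> Prop) x j c s :
  I 0 s ->
  (forall i s', i < s.1.1 0 j -> I i s' -> I i.+1 (run c (set_var s' x i))) ->
  I (s.1.1 0 j) (run (For x j c) s).
Proof.
move=> I0 IS /=; elim: {-2}(s.1.1 0 j) (leqnn (s.1.1 0 j)) => //= n IHn ltn.
by apply: IS => //; apply: IHn; apply: ltnW.
Qed.

Lemma run_For_out (K : state -> Prop) (g : nat -> seq nat) x j c s :
  K s ->
  (forall i s', i < s.1.1 0 j -> K s' ->
     K (run c (set_var s' x i)) /\ (run c (set_var s' x i)).2 = s'.2 ++ g i) ->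
  K (run (For x j c) s) /\
  (run (For x j c) s).2 = s.2 ++ flatten [seq g i | i <- iota 0 (s.1.1 0 j)].
Proof.
move=> Ks Kc.
apply: (run_For_ind (I := fun i s' => K s' /\ s'.2 = s.2 ++ flatten [seq g i | i <- iota 0 i])).
  by rewrite cats0.
move=> i s' lti [Ks' E']; have [K' E] := Kc i s' lti Ks'; split=> //.
by rewrite E E' -addn1 iotaD map_cat flatten_cat /= cats0 catA.
Qed.

(* Variables, as indices into array 1, and arrays, as numbered by [Get]. *)
Notation xu := 0 (only parsing).
Notation xv := 1 (only parsing).
Notation xcount := 2 (only parsing).
Notation xw := 3 (only parsing).
Notation xa := 4 (only parsing).
Notation xb := 5 (only parsing).
Notation xcur := 6 (only parsing).
Notation xbest := 7 (only parsing).
Notation xprice := 8 (only parsing).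
Notation xfail := 9 (only parsing).
Notation xold := 10 (only parsing).
Notation xi := 11 (only parsing).
Notation xt := 12 (only parsing).

Notation ahost := 1 (only parsing).
Notation apat := 2 (only parsing).
Notation acenter := 3 (only parsing).
Notation aroot := 4 (only parsing).
Notation aown := 5 (only parsing).
Notation aprice := 6 (only parsing).
Notation ajunk := 7 (only parsing).

Definition Var (x : nat) : expr := Get 0 (Cst x).
Definition Assign (x : nat) (e : expr) : cmd := Put 0 (Cst x) e.

(* The product of [e1] and [e2], provided that [e1] is at most [Par j]. *)
Definition Times (j : nat) (e1 e2 : expr) : expr :=
  SumE xt j (IfE (Minus e1 (Var xt)) e2 (Cst 0)).

(** The sum adds [b] once for every [t] below [a]. Since it overwrites [xt], the operands must not
    depend on that variable. *)
Lemma eval_Times m j e1 e2 a b :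
  (forall t, eval (set_cell m 1 xt t) e1 = a) ->
  (forall t, eval (set_cell m 1 xt t) e2 = b) ->
  a <= m 0 j -> eval m (Times j e1 e2) = a * b.
Proof.
move=> E1 E2 le /=; under eq_bigr => t _ do rewrite E1 E2 subn_gt0.
by rewrite -big_mkcond big_ord_narrow // sum_nat_const card_ord.
Qed.

(** * Reading matrices and lists *)

Definition read_cells (a j1 j2 : nat) : cmd :=
  For xu j1 (For xv j2
    (Seq (Inp a (Var xcount)) (Assign xcount (Plus (Var xcount) (Cst 1))))).

Definition read_array (a j1 j2 : nat) : cmd :=
  Seq (Assign xcount (Cst 0)) (read_cells a j1 j2).

(** Array 1 is excluded since the counters live there, and [0 < a] keeps the target array away from
    it. *)
Lemma run_read_array a j1 j2 s0 : 0 < a ->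
  let s := run (read_array a j1 j2) s0 in
  let L := s0.1.1 0 j1 * s0.1.1 0 j2 in
  [/\ s.2 = s0.2, s.1.2 = drop L s0.1.2
    & forall b i, b != 1 ->
        s.1.1 b i = if (b == a.+1) && (i < L) then nth 0 s0.1.2 i else s0.1.1 b i].
Proof.
case: a s0 => // a [[m u] w] _ s L; rewrite /= in L *.
pose J q (s : state) := [/\ s.2 = w, s.1.2 = drop q u, s.1.1 1 xcount = q
  & forall b i, b != 1 ->
        s.1.1 b i = if (b == a.+2) && (i < q) then nth 0 u i else m b i].
suff [] : J L s by [].
pose s0 := run (Assign xcount (Cst 0)) (m, u, w).
have J0 : J (0 * m 0 j2) s0.
  split=> //=; first by rewrite drop0.
  by move=> b i b1; rewrite /set_cell (negPf b1) ltn0 andbF.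
have -> : s = run (read_cells a.+1 j1 j2) s0 by [].
apply: (@run_For_ind (fun q => J (q * m 0 j2)) xu j1 _ s0) => //.
move=> i s1 _ J1; set s2 := set_var _ _ _.
have E2 : s2.1.1 0 j2 = m 0 j2 by have [_ _ _] := J1; apply.
rewrite mulSn addnC -{2}E2; apply: (run_For_ind (I := fun q => J (_ + q))).
  rewrite addn0; have [? ? ? H] := J1; split=> // b k b1.
  by rewrite /= /set_cell (negPf b1) H.
move=> k s3 _ [H1 H2 H3 H4]; rewrite addnS; set q := _ + _ in H2 H3 H4 *.
split=> //=; first by rewrite H2 -drop1 drop_drop add1n.
  by rewrite /set_cell /= H3 addn1.
move=> b y b1; rewrite /set_cell (negPf b1) /= H3 -nth0 H2 nth_drop addn0 ltnS.
rewrite H4 // [y <= q]leq_eqVlt; case: eqP => [->|_] //=.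
by have [->|_] := eqVneq y q.
Qed.

(** * The auction and the output as commands *)

(** The distance of two values: under truncated subtraction at most one summand is nonzero. *)
Definition neqE (e1 e2 : expr) : expr := Plus (Minus e1 e2) (Minus e2 e1).

Lemma eval_neqE m e1 e2 : (0 < eval m (neqE e1 e2)) = (eval m e1 != eval m e2).
Proof. by rewrite /neqE /=; lia. Qed.

#[local] Opaque neqE Times.

(* Counts the reasons why pattern vertex [w] may not be mapped to host
   vertex [v]. *)
Definition obstruction (w v : expr) : expr :=
  let c := Get acenter (Var xi) in
  let r := Get aroot (Var xi) in
  SumE xi 2
    (Plus (IfE (neqE w c) (Cst 0) (IfE (neqE v r) (Cst 1) (Cst 0)))
    (Plus (IfE (Get apat (Plus (Times 1 c (Par 1)) w))
               (IfE (Get ahost (Plus (Times 0 r (Par 0)) v)) (Cst 0) (Cst 1)) (Cst 0))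
          (IfE (Get apat (Plus (Times 1 w (Par 1)) c))
               (IfE (Get ahost (Plus (Times 0 v (Par 0)) r)) (Cst 0) (Cst 1)) (Cst 0)))).

Definition scan : cmd :=
  For xv 0
    (If (obstruction (Minus (Var xcur) (Cst 1)) (Var xv)) Skip
       (If (Minus (Var xprice) (Get aprice (Var xv)))
           (Seq (Assign xbest (Plus (Var xv) (Cst 1)))
                (Assign xprice (Get aprice (Var xv))))
           Skip)).

(** [xbest] is a host vertex plus one, or 0 for none. With [xprice] starting at n, the strict
    comparison in [scan] rejects vertices whose price has reached n. *)
Definition search : cmd :=
  Seq (Seq (Assign xbest (Cst 0)) (Assign xprice (Par 0))) scan.

(** The evicted owner, or 0 for a free vertex, is the next bidder. On failure the bidder is dropped,
    so the remaining bids of the round are idle. *)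
Definition place : cmd :=
  If (Var xbest)
    (Seq (Assign xbest (Minus (Var xbest) (Cst 1)))
    (Seq (Assign xold (Get aown (Var xbest)))
    (Seq (Put aown (Var xbest) (Var xcur))
    (Seq (Put aprice (Var xbest) (Plus (Var xprice) (Cst 1)))
         (Assign xcur (Var xold))))))
    (Seq (Assign xfail (Cst 1)) (Assign xcur (Cst 0))).

Definition bid : cmd := If (Var xcur) (Seq search place) Skip.

Definition bids : cmd := For xa 3 (For xb 3 bid).

Definition match_all : cmd :=
  For xw 1
    (Seq (Assign xcur (Plus (Var xw) (Cst 1)))
         bids).

Definition output_verts : cmd :=
  For xv 0 (Out (IfE (Get aown (Var xv)) (Cst 1) (Cst 0))).

Definition output_row : cmd :=
  let u := Get aown (Var xu) in
  let v := Get aown (Var xv) in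
  For xv 0
    (Out (IfE u (IfE v
       (Get apat (Plus (Times 1 (Minus u (Cst 1)) (Par 1)) (Minus v (Cst 1))))
       (Cst 0)) (Cst 0))).

Definition output_arcs : cmd := For xu 0 output_row.

Definition output : cmd :=
  If (Var xfail) (Out (Cst 0))
    (Seq (Out (Cst 1)) (Seq output_verts output_arcs)).

(** On the tape, the code of [rootset], taken in by [ajunk], stands between centers and roots. *)
Definition read_input : cmd :=
  Seq (read_array ahost 0 0) (Seq (read_array apat 1 1) (Seq (read_array acenter 2 4)
      (Seq (read_array ajunk 0 4) (read_array aroot 2 4)))).

Definition solve : cmd :=
  Seq read_input
  (Seq (Seq (Assign xcur (Cst 0)) (Assign xfail (Cst 0))) (Seq match_all output)).

(** * Verification of the auction *)

Section Tables.

Variables (n p k : nat) (H A C R : nat -> nat).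
Hypothesis C_le : forall i, i < k -> C i <= p.
Hypothesis R_le : forall i, i < k -> R i <= n.

Definition tables (m : store) : Prop :=
  [/\ m 0 =1 params n p k 0, m ahost.+1 =1 H, m apat.+1 =1 A, m acenter.+1 =1 C
    & m aroot.+1 =1 R].

(** [compatible] expressed by lookups in the row-major tables, over plain numbers as the machine
    sees them. *)
Definition adj (w v : nat) : bool :=
  [forall i : 'I_k,
    [&& (w == C i) ==> (v == R i),
        (0 < A (C i * p + w)) ==> (0 < H (R i * n + v))
      & (0 < A (w * p + C i)) ==> (0 < H (v * n + R i))]].

(** A sum vanishes exactly when all its terms do, which matches the universal quantifier in [adj].
    The bounds on [C], [R], [w] and [v] are those that [eval_Times] demands. *)
Lemma eval_obstruction m w v :
  tables m -> m 1 xcur = w.+1 -> m 1 xv = v -> w <= p -> v <= n ->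
  (0 < eval m (obstruction (Minus (Var xcur) (Cst 1)) (Var xv))) = ~~ adj w v.
Proof.
move=> [mP mH mA mC mR] mw mv wp vn.
rewrite lt0n; congr (~~ _).
rewrite [eval _ _]/= sum_nat_eq0 mP; apply: eq_forallb => -[i ik] /=.
set m' := set_cell m 1 xi i.
have [Ei Ew Ev] : [/\ m' 1 xi = i, m' 1 xcur = w.+1 & m' 1 xv = v] by [].
have EC : m' acenter.+1 (m' 1 xi) = C i by rewrite Ei -mC.
have ER : m' aroot.+1 (m' 1 xi) = R i by rewrite Ei -mR.
have En : m' 0 0 = n by rewrite [LHS]mP.
have Ep : m' 0 1 = p by rewrite [LHS]mP.
have [Ci Ri] := (C_le ik, R_le ik).
have T1 : eval m' (Times 1 (Get acenter (Var xi)) (Par 1)) = C i * p.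
  by apply: eval_Times; rewrite ?Ep.
have T2 : eval m' (Times 0 (Get aroot (Var xi)) (Par 0)) = R i * n.
  by apply: eval_Times; rewrite ?En.
have T3 : eval m' (Times 1 (Minus (Var xcur) (Cst 1)) (Par 1)) = w * p.
  by apply: eval_Times; rewrite ?Ep // => t; rewrite [LHS](_ : _ = m' 1 xcur - 1) // Ew subn1.
have T4 : eval m' (Times 0 (Var xv) (Par 0)) = v * n.
  by apply: eval_Times; rewrite ?En.
rewrite !eval_neqE T1 T2 T3 T4 /= EC ER Ew Ev subn1 /= /m' /set_cell /= !mA !mH.
by case: (w == C i); case: (v == R i); do 4?[case: (0 < _)].
Qed.

(** Array 1 holds the variables, and arrays 6 and 7 the owners and prices; the tables lie in the
    others. *)
Lemma eq_tables m m' :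
  (forall a i, a != 1 -> a < 6 -> m' a i = m a i) -> tables m -> tables m'.
Proof. by move=> E [? ? ? ? ?]; split=> i; rewrite E. Qed.

#[local] Opaque obstruction.

Lemma run_search m u o w :
  tables m -> m 1 xcur = w.+1 -> w <= p ->
  let s := run search (m, u, o) in
  [/\ s.2 = o,
      forall a i, (a != 1) || (i \notin [:: xv; xbest; xprice]) -> s.1.1 a i = m a i
    & (s.1.1 1 xbest = 0 /\ forall v, v < n -> adj w v -> n <= m aprice.+1 v) \/
      (exists v, [/\ s.1.1 1 xbest = v.+1, s.1.1 1 xprice = m aprice.+1 v &
         [/\ v < n, adj w v, m aprice.+1 v < n
           & forall v', v' < n -> adj w v' -> m aprice.+1 v <= m aprice.+1 v']])].
Proof.
move=> Tm mw wp s.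
(* In both cases [xprice] is the minimum of n and the prices of the neighbours below [t]. *)
pose J t (s : state) := [/\ s.2 = o,
      forall a i, (a != 1) || (i \notin [:: xv; xbest; xprice]) -> s.1.1 a i = m a i
    & [/\ s.1.1 1 xbest = 0, s.1.1 1 xprice = n
        & forall v, v < t -> adj w v -> n <= m aprice.+1 v] \/
      (exists v, [/\ s.1.1 1 xbest = v.+1, s.1.1 1 xprice = m aprice.+1 v &
         [/\ v < t, adj w v, m aprice.+1 v < n
           & forall v', v' < t -> adj w v' -> m aprice.+1 v <= m aprice.+1 v']])].
have mn : m 0 0 = n by have [mP _ _ _ _] := Tm; apply: mP.
suff [So Sm Sb] : J n s.
  by split=> //; case: Sb => [[? _ ?]|?]; [left | right].
pose s0 := run (Seq (Assign xbest (Cst 0)) (Assign xprice (Par 0))) (m, u, o).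
have -> : s = run scan s0 by [].
rewrite -{1}mn; apply: (@run_For_ind J xv 0 _ s0).
  split=> //; last by left; split; rewrite //= mn.
  move=> a i; rewrite /= /set_cell !inE; case: eqP => [->|//] /=.
  by rewrite !negb_or => /and3P[_ /negPf-> /negPf->].
move=> i s1; rewrite [_ 0 0](_ : _ = n) // => lti [So Sm Sb].
set s2 := set_var s1 xv i.
have Sm2 a y : (a != 1) || (y \notin [:: xv; xbest; xprice]) -> s2.1.1 a y = m a y.
  move=> ay; rewrite -Sm //= /set_cell; case: eqP ay => [->|//] /=.
  by case: eqP => [->|].
have T2 : tables s2.1.1 by apply: eq_tables Tm => a y a1 _; rewrite Sm2 ?a1.
have [eb ep] : s2.1.1 1 xbest = s1.1.1 1 xbest /\ s2.1.1 1 xprice = s1.1.1 1 xprice by [].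
have e7 y : s2.1.1 aprice.+1 y = m aprice.+1 y by rewrite Sm2.
(* Covers both ways in which a round changes nothing: [i] is not a neighbour, or it is no cheaper
   than the current best. *)
have keep : (adj w i -> s2.1.1 1 xprice <= m aprice.+1 i) -> J i.+1 s2.
  move=> wi; split=> //; rewrite ep in wi *; rewrite eb.
  case: Sb => [[b0 pn all]|[v [bv pv [vi wv vn min]]]]; [left | right].
    split=> // v; rewrite ltnS leq_eqVlt => /predU1P[-> /wi|]; first by rewrite pn.
    exact: all.
  exists v; split=> //; split=> // [|v']; first exact: leqW.
  by rewrite ltnS leq_eqVlt => /predU1P[-> /wi|]; [rewrite pv | apply: min].
have obs : (0 < eval s2.1.1 (obstruction (Minus (Var xcur) (Cst 1)) (Var xv))) = ~~ adj w i.
  by apply: eval_obstruction; rewrite // ?Sm2 // ltnW.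
rewrite [run _ _]/= -/s2 obs.
case: ifP => [/negPf nadj|/negbFE wi]; first by apply: keep; rewrite nadj.
rewrite -[set_cell s1.1.1 1 xv i]/(s2.1.1) (_ : s2.1.1 1 xv = i) // !e7.
case: ifP => [lt|/negbT nlt]; last by apply: keep => _; lia.
have in_ : m aprice.+1 i < n.
  by case: Sb => [[_ pn _]|[v [_ pv [_ _ vn _]]]]; rewrite ep in lt; lia.
split=> //=.
  move=> a y ay; rewrite -(Sm _ _ ay) /s2 /= /set_cell.
  move: ay; rewrite !inE; case: eqP => [->|//] /=.
  by rewrite !negb_or => /and3P[/negPf-> /negPf-> /negPf->].
right; exists i; split=> /=; [exact: addn1 | exact: e7 | ].
split=> // v'; rewrite ltnS leq_eqVlt => /predU1P[->//|v'i wv'].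
case: Sb => [[_ pn all]|[v [_ pv [_ _ vn min]]]]; rewrite ep in lt.
  by have := all _ v'i wv'; lia.
by have := min _ v'i wv'; lia.
Qed.

#[local] Opaque search.

(** A set failure flag stands for a fact about [adj] alone, so later steps cannot invalidate it. *)
Definition state_inv (q : nat) (m : store) : Prop :=
  [/\ tables m, auction n adj q (m aown.+1) (m aprice.+1) (m 1 xcur)
    & 0 < m 1 xfail ->
      ~ exists2 phi : 'I_p -> 'I_n, injective phi & forall w : 'I_p, adj w (phi w)].

(** Preserved by every bid, since an evicted owner becomes the bidder. Without bidder or failure it
    says that [w] is matched. *)
Definition claimed (m : store) (w : nat) : Prop :=
  [\/ 0 < m 1 xfail, m 1 xcur = w.+1 | exists2 v, v < n & m aown.+1 v = w.+1].

Definition total_price (m : store) : nat := \sum_(v < n) m aprice.+1 v.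

(** The total price is the progress measure: a successful bid raises it by one, and a failed one
    leaves no bidder. *)
Lemma run_bid q s : q <= p -> state_inv q s.1.1 ->
  let s' := run bid s in
  [/\ s'.2 = s.2, state_inv q s'.1.1,
      forall w, claimed s.1.1 w -> claimed s'.1.1 w
    & s'.1.1 1 xcur = 0 \/ total_price s'.1.1 = (total_price s.1.1).+1].
Proof.
case: s => [[m u] o] qp [/= Tm Am Fm]; rewrite /bid /=.
case: (posnP (m 1 xcur)) => [c0|]; first by split=> //; left.
case mw: (m 1 xcur) => [//|w] _; rewrite mw in Am.
have wp : w < p := leq_trans (auction_cur Am) qp.
have [] := run_search u o Tm mw (ltnW wp).
case: (run search _) => [[m1 u1] o1] /= -> Sm best.
have T1 : tables m1 by apply: eq_tables Tm => a y a1 _; rewrite Sm ?a1.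
case: best => [[b0 high]|[v [bv pv [vn wv pn min]]]]; rewrite ?b0 ?bv /=.
- split=> //.
  + split=> /=.
    * by apply: eq_tables T1 => a y a1 _; rewrite /set_cell !(negPf a1).
    * apply: (auction_drop (eq_auction _ _ Am)) => y /=; by rewrite /set_cell /= Sm.
    * move=> _; exact: auction_fail qp Am high.
  + by move=> w' _; apply: Or31.
  + by left.
- rewrite subn1 /=; set m2 : store := set_cell _ 1 xcur _.
  have E6 : m2 aown.+1 =1 upd (m aown.+1) v w.+1.
    by move=> y; rewrite /m2 /set_cell /= updE !Sm //= mw.
  have E7 : m2 aprice.+1 =1 upd (m aprice.+1) v (m aprice.+1 v).+1.
    by move=> y; rewrite /m2 /set_cell /= updE pv addn1 Sm.
  have Ecur : m2 1 xcur = m aown.+1 v by rewrite /m2 /set_cell /= Sm.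
  have Efail : m2 1 xfail = m 1 xfail by rewrite /m2 /set_cell /= Sm.
  have E0 a y : a != 1 -> a < 6 -> m2 a y = m a y.
    move=> a1 a6; rewrite /m2 /set_cell !(negPf a1) (ltn_eqF a6) (ltn_eqF (leqW a6)) /=.
    by rewrite Sm ?a1.
  clearbody m2; split=> //.
  + split=> /=; last by rewrite Efail.
    * exact: eq_tables E0 Tm.
    * rewrite Ecur; apply: eq_auction (fsym E6) (fsym E7) _.
      exact: auction_bid Am vn wv pn min.
  + move=> w' [fl|/=|[v' v'n Ev']]; first by apply: Or31; rewrite /= Efail.
      rewrite mw => -[<-]; apply: Or33; exists v; first by [].
      by rewrite /= E6 updE eqxx.
    (* If the vertex of [w'] is the one just taken, then [w'] has been evicted and is now the
       bidder. *)
    have [E|ne] := eqVneq v' v; first by apply: Or32; rewrite /= Ecur -E.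
    by apply: Or33; exists v'; rewrite //= E6 updE (negPf ne).
  + right; rewrite /total_price /= (bigD1 (Ordinal vn)) //= [in RHS](bigD1 (Ordinal vn)) //=.
    rewrite E7 updE eqxx addSn; congr (_ + _).+1; apply: eq_bigr => y ne.
    by rewrite E7 updE; case: eqP => // yv; rewrite -val_eqE /= yv eqxx in ne.
Qed.

Lemma run_bid_idle s : s.1.1 1 xcur = 0 -> run bid s = s.
Proof. by rewrite /bid /= => ->. Qed.

Lemma total_price_le q m : state_inv q m -> total_price m <= n * n.
Proof.
case=> _ Au _; rewrite -[X in X * _]card_ord -sum_nat_const; apply: leq_sum => v _.
exact: (auction_price Au).
Qed.

#[local] Opaque bid.

(** Invariant after [b] bids from [s0]: a bidder that is still active forces a total price of at
    least [b]. *)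
Definition running (q : nat) (s0 : state) (b : nat) (s : state) : Prop :=
  [/\ s.2 = s0.2, state_inv q s.1.1, forall w, claimed s0.1.1 w -> claimed s.1.1 w
    & s.1.1 1 xcur = 0 \/ b <= total_price s.1.1].

Lemma state_inv_set_var q (s : state) x i :
  x \notin [:: xcur; xfail] -> state_inv q s.1.1 -> state_inv q (set_var s x i).1.1.
Proof.
rewrite !inE negb_or => /andP[x1 x2] [T Au F]; split.
- by apply: eq_tables T => a y a1 _; rewrite /= /set_cell (negPf a1).
- by rewrite /= {3}/set_cell /= eq_sym (negPf x1).
- by rewrite /= /set_cell /= eq_sym (negPf x2).
Qed.

Lemma running_set_var q s0 b (s : state) x i :
  x \notin [:: xcur; xfail] -> running q s0 b s -> running q s0 b (set_var s x i).
Proof.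
move=> xN [So I Cl P]; split=> //; first exact: state_inv_set_var.
  move=> w /Cl; rewrite /claimed /= /set_cell /=.
  by move: xN; rewrite !inE negb_or => /andP[]; rewrite ![x == _]eq_sym => /negPf-> /negPf->.
by move: xN; rewrite !inE negb_or => /andP[]; rewrite /= {1}/set_cell /= ![x == _]eq_sym => /negPf-> _.
Qed.

Lemma running_bid q s0 b s : q <= p -> running q s0 b s -> running q s0 b.+1 (run bid s).
Proof.
move=> qp [So I Cl P]; case: (posnP (s.1.1 1 xcur)) => [c0|cpos].
  by rewrite run_bid_idle //; split=> //; left.
have [Eo I' Cl' P'] := run_bid qp I; split=> //.
- by rewrite Eo.
- by move=> w /Cl/Cl'.
- case: P' => [->|->]; first by left.
  by right; case: P => [c0|//]; rewrite c0 in cpos.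
Qed.

(* The prices cannot add up to (n + 1)^2, so that many bids are enough. *)
Lemma run_bids q s : q <= p -> state_inv q s.1.1 ->
  let s' := run bids s in
  [/\ s'.2 = s.2, state_inv q s'.1.1, forall w, claimed s.1.1 w -> claimed s'.1.1 w
    & s'.1.1 1 xcur = 0].
Proof.
move=> qp I.
have par3 (s' : state) : state_inv q s'.1.1 -> s'.1.1 0 3 = n.+1.
  by case=> -[E _ _ _ _] _ _; rewrite E.
have : running q s (n.+1 * n.+1) (run bids s).
  rewrite -{1}(par3 s I); apply: (run_For_ind (I := fun i => running q s (i * n.+1))).
    by split=> //; right.
  move=> i s1 _ R1; set s2 := set_var _ _ _.
  have R2 : running q s (i * n.+1) s2 by apply: running_set_var.
  rewrite mulSn addnC -{2}(par3 s2) //; last by have [] := R2.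
  apply: (run_For_ind (I := fun j => running q s (i * n.+1 + j))).
    by rewrite addn0.
  move=> j s3 _ R3; rewrite addnS; apply: running_bid => //.
case=> So I' Cl P; split=> //; case: P => // le.
by have := leq_trans le (total_price_le I'); rewrite leqNgt ltn_mul.
Qed.

#[local] Opaque bids.

Lemma run_match_all s :
  state_inv 0 s.1.1 -> s.1.1 1 xcur = 0 ->
  let s' := run match_all s in
  [/\ s'.2 = s.2, state_inv p s'.1.1 & forall w, w < p ->
     0 < s'.1.1 1 xfail \/ exists2 v, v < n & s'.1.1 aown.+1 v = w.+1].
Proof.
move=> I c0.
(* Between rounds nobody bids, so after the last one every claim is a match or a failure. *)
pose J q (s' : state) := [/\ s'.2 = s.2, state_inv q s'.1.1, s'.1.1 1 xcur = 0
  & forall w, w < q -> claimed s'.1.1 w].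
have p1 : s.1.1 0 1 = p by case: I => -[E _ _ _ _] _ _; rewrite E.
suff [So' I' c' Cl'] : J p (run match_all s).
  split=> // w /Cl' [?|cw|?]; [by left | by rewrite c' in cw | by right].
rewrite -{1}p1; apply: run_For_ind; first by split.
move=> q s1; rewrite p1 => qp [So I1 c1 Cl]; set s2 := set_var s1 xw q.
rewrite [run _ _]/=; set s3 := (X in run bids X).
have I2 : state_inv q.+1 s3.1.1.
  case: I1 => T Au F; split.
  - by apply: eq_tables T => a y a1 _; rewrite /= /set_cell !(negPf a1).
  - rewrite c1 in Au.
    have -> : s3.1.1 1 xcur = q.+1 by rewrite -[RHS]addn1.
    exact: auction_next Au.
  - exact: F.
have [So' I' Cl' c'] := run_bids qp I2; split=> //.
  by rewrite So'.
move=> w; rewrite ltnS leq_eqVlt => /predU1P[->|/Cl Cw]; apply: Cl'.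
  by apply: Or32; rewrite -[RHS]addn1.
case: Cw => [?|cw|?]; [exact: Or31 | by rewrite c1 in cw | exact: Or33].
Qed.

(** * Verification of the output *)

Definition out_arc (own : nat -> nat) (u v : nat) : nat :=
  if 0 < own u then
    if 0 < own v then A ((own u - 1) * p + (own v - 1)) else 0
  else 0.

(** The output commands change nothing but loop variables, all of which lie in array 1. *)
Definition agree (m m' : store) : Prop := forall a i, a != 1 -> m' a i = m a i.

Lemma agree_set_var m (s : state) x i : agree m s.1.1 -> agree m (set_var s x i).1.1.
Proof. by move=> E a y a1; rewrite /= /set_cell (negPf a1) E. Qed.

Lemma run_output_verts s : tables s.1.1 ->
  let s' := run output_verts s in
  agree s.1.1 s'.1.1 /\
  s'.2 = s.2 ++ [seq (if 0 < s.1.1 aown.+1 v then 1 else 0) | v <- iota 0 n].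
Proof.
case=> P _ _ _ _.
have := @run_For_out (fun s' => agree s.1.1 s'.1.1)
  (fun v => [:: if 0 < s.1.1 aown.+1 v then 1 else 0]) xv 0
  (Out (IfE (Get aown (Var xv)) (Cst 1) (Cst 0))) s.
rewrite flatten_map1 [s.1.1 0 0]P; apply=> // i s' _ K; split; first exact: agree_set_var.
by rewrite /= -cats1 /set_cell /= K.
Qed.

Lemma run_output_row s u : tables s.1.1 ->
  (forall v, v < n -> s.1.1 aown.+1 v <= p) -> u < n -> s.1.1 1 xu = u ->
  let s' := run output_row s in
  agree s.1.1 s'.1.1 /\
  s'.2 = s.2 ++ [seq out_arc (s.1.1 aown.+1) u v | v <- iota 0 n].
Proof.
case=> P _ EA _ _ own_le un Eu.
pose e := Get aown (Var xu); pose e' := Get aown (Var xv).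
have [] // := @run_For_out (fun s' => agree s.1.1 s'.1.1 /\ s'.1.1 1 xu = u)
  (fun v => [:: out_arc (s.1.1 aown.+1) u v]) xv 0
  (Out (IfE e (IfE e'
       (Get apat (Plus (Times 1 (Minus e (Cst 1)) (Par 1)) (Minus e' (Cst 1))))
       (Cst 0)) (Cst 0))) s.
  move=> v s' _ [K Eu']; split; first by split; [exact: agree_set_var | ].
  rewrite /= -cats1; congr (_ ++ [:: _]).
  set m := set_cell _ 1 xv v.
  have Ep : m 0 1 = p by rewrite /m /set_cell /= K // P.
  have -> : eval m (Times 1 (Minus e (Cst 1)) (Par 1)) = (s.1.1 aown.+1 u - 1) * p.
    apply: eval_Times => [t|t|]; rewrite ?Ep //=.
      by rewrite /m /set_cell /= Eu' K.
    by apply: leq_trans (leq_subr _ _) (own_le _ un).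
  by rewrite /m /set_cell /= Eu' !K // EA.
move=> [K _] E; split=> //.
by rewrite flatten_map1 in E; rewrite E [s.1.1 0 0]P.
Qed.

#[local] Opaque output_row.

Lemma run_output_arcs s : tables s.1.1 ->
  (forall v, v < n -> s.1.1 aown.+1 v <= p) ->
  (run output_arcs s).2 = s.2 ++
    flatten [seq [seq out_arc (s.1.1 aown.+1) u v | v <- iota 0 n] | u <- iota 0 n].
Proof.
move=> T own_le; have [P _ _ _ _] := T.
have [] // := @run_For_out (fun s' => agree s.1.1 s'.1.1)
  (fun u => [seq out_arc (s.1.1 aown.+1) u v | v <- iota 0 n]) xu 0 output_row s.
  rewrite [s.1.1 0 0]P => u s' un K; set s2 := set_var s' xu u.
  have K2 : agree s.1.1 s2.1.1 by apply: agree_set_var.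
  have [] := @run_output_row s2 u.
  - by apply: eq_tables T => a y a1 _; apply: K2.
  - by move=> v vn; rewrite K2 ?own_le.
  - by [].
  - by [].
  move=> K3 ->; split; first by move=> a y a1; rewrite K3 ?K2.
  congr (_ ++ _); apply: eq_map => v.
  by rewrite /out_arc !K2.
by rewrite [s.1.1 0 0]P.
Qed.

#[local] Opaque output_verts output_arcs.

Lemma run_output s :
  tables s.1.1 -> s.2 = [::] ->
  (forall v, v < n -> s.1.1 aown.+1 v <= p) ->
  (run output s).2 =
    if 0 < s.1.1 1 xfail then [:: 0] else
    1 :: [seq (if 0 < s.1.1 aown.+1 v then 1 else 0) | v <- iota 0 n] ++
    flatten [seq [seq out_arc (s.1.1 aown.+1) u v | v <- iota 0 n] | u <- iota 0 n].
Proof.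
move=> T s_out own_le; rewrite /output /= s_out; case: ifP => //= _.
set s1 := (_, _, [:: 1]).
have [K E] := @run_output_verts s1 T.
rewrite run_output_arcs; first rewrite E /=.
- congr (1 :: _ ++ _); congr flatten; apply: eq_map => u; apply: eq_map => v.
  by rewrite /out_arc !K.
- by apply: eq_tables T => a y a1 _; rewrite K.
- by move=> v vn; rewrite K ?own_le.
Qed.

End Tables.

(* Correctness on encoded instances *)
#[local] Opaque read_array.

Lemma run_read_input n p k (t1 t2 t3 t4 t5 : seq nat) :
  size t1 = n * n -> size t2 = p * p -> size t3 = k -> size t4 = n -> size t5 = k ->
  let s := run read_input (params n p k, t1 ++ t2 ++ t3 ++ t4 ++ t5, [::]) in
  s.2 = [::] /\
  [/\ s.1.1 0 =1 params n p k 0,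
      forall i, i < n * n -> s.1.1 ahost.+1 i = nth 0 t1 i,
      forall i, i < p * p -> s.1.1 apat.+1 i = nth 0 t2 i,
      forall i, i < k -> s.1.1 acenter.+1 i = nth 0 t3 i
    & [/\ forall i, i < k -> s.1.1 aroot.+1 i = nth 0 t5 i,
          s.1.1 aown.+1 =1 (fun=> 0) & s.1.1 aprice.+1 =1 (fun=> 0)]].
Proof.
move=> z1 z2 z3 z4 z5 s.
pose s0 : state := (params n p k, t1 ++ t2 ++ t3 ++ t4 ++ t5, [::]).
pose s1 := run (read_array ahost 0 0) s0.
pose s2 := run (read_array apat 1 1) s1.
pose s3 := run (read_array acenter 2 4) s2.
pose s4 := run (read_array ajunk 0 4) s3.
have -> : s = run (read_array aroot 2 4) s4 by [].
have [O1 U1 M1] := @run_read_array ahost 0 0 s0 isT.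
rewrite drop_size_cat // -/s1 in U1 M1 O1.
have [O2 U2 M2] := @run_read_array apat 1 1 s1 isT.
rewrite -/s2 U1 !M1 //= drop_size_cat // in U2 M2 O2.
have [O3 U3 M3] := @run_read_array acenter 2 4 s2 isT.
rewrite -/s3 U2 !M2 ?M1 //= muln1 drop_size_cat // in U3 M3 O3.
have [O4 U4 M4] := @run_read_array ajunk 0 4 s3 isT.
rewrite -/s4 U3 !M3 ?M2 ?M1 //= muln1 drop_size_cat // in U4 M4 O4.
have [O5 U5 M5] := @run_read_array aroot 2 4 s4 isT.
rewrite U4 !M4 ?M3 ?M2 ?M1 //= muln1 in U5 M5 O5.
split; first by rewrite O5 O4 O3 O2 O1.
split=> [i|i lti|i lti|i lti|].
- by rewrite M5 // M4 // M3 // M2 // M1.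
- by rewrite M5 // M4 // M3 // M2 // M1 //= lti nth_cat z1 lti.
- by rewrite M5 // M4 // M3 // M2 //= lti nth_cat z2 lti.
- by rewrite M5 // M4 // M3 //= lti nth_cat z3 lti.
split=> [i lti|i|i].
- by rewrite M5 //= lti.
- by rewrite M5 // M4 // M3 // M2 // M1.
- by rewrite M5 // M4 // M3 // M2 // M1.
Qed.

Lemma nth_flatten_rows (T : Type) (x0 : T) (n : nat) (ss : seq (seq T)) u v :
  all (fun s => size s == n) ss -> u < size ss -> v < n ->
  nth x0 (flatten ss) (u * n + v) = nth x0 (nth [::] ss u) v.
Proof.
elim: ss u => [|s ss IH] [|u] //= /andP[/eqP sn all_n] us vn; rewrite nth_cat sn.
  by rewrite vn.
by rewrite mulSn -addnA ltnNge leq_addr /= addKn IH.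
Qed.

Lemma size_arcs_code p (G : digraph 'I_p) : size (arcs_code G) = p * p.
Proof. by rewrite size_allpairs size_enum_ord. Qed.

Lemma nth_arcs_code p (G : digraph 'I_p) (u v : 'I_p) :
  nth 0 (arcs_code G) (u * p + v) = ((u, v) \in arcs G).
Proof.
rewrite nth_flatten_rows //.
- rewrite (nth_map u) ?size_enum_ord // (nth_map u) ?size_enum_ord //.
  by rewrite !nth_ord_enum.
- by apply/allP => _ /mapP[w _ ->]; rewrite size_map size_enum_ord.
- by rewrite size_map size_enum_ord.
Qed.

Lemma map_enum_ord (T : Type) n (f : nat -> T) (g : 'I_n -> T) :
  (forall v : 'I_n, g v = f v) -> [seq g v | v <- enum 'I_n] = [seq f v | v <- iota 0 n].
Proof. by move=> E; rewrite -val_enum_ord -map_comp; apply: eq_map. Qed.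

Lemma run_solve (x : instance) :
  correct_output x
    (run solve (params (host_size x) (pat_size x) (nstars x),
                drop 3 (encode x), [::])).2.
Proof.
set n := host_size x; set p := pat_size x; set k := nstars x.
pose t1 := arcs_code (host x); pose t2 := arcs_code (pat x).
pose t3 := [seq nat_of_ord (center x i) | i <- enum 'I_k].
pose t5 := [seq nat_of_ord (root_of x i) | i <- enum 'I_k].
have z3 : size t3 = k by rewrite size_map size_enum_ord.
have z4 : size (set_code (rootset x)) = n by rewrite size_map size_enum_ord.
have z5 : size t5 = k by rewrite size_map size_enum_ord.
have := run_read_input (size_arcs_code (host x)) (size_arcs_code (pat x)) z3 z4 z5.
rewrite -/t1 -/t2.
have -> : t1 ++ t2 ++ t3 ++ set_code (rootset x) ++ t5 = drop 3 (encode x) by rewrite /encode /= drop0.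
set s1 := run read_input _ => -[s1_out [P HH AA CC [RR own0 price0]]].
pose s2 := run (Seq (Assign xcur (Cst 0)) (Assign xfail (Cst 0))) s1.
pose s3 := run match_all s2.
pose C := s1.1.1 acenter.+1; pose R := s1.1.1 aroot.+1.
pose H := s1.1.1 ahost.+1; pose A := s1.1.1 apat.+1.
have CE (i : 'I_k) : C i = center x i.
  by rewrite /C CC // (nth_map i) ?size_enum_ord // nth_ord_enum.
have RE (i : 'I_k) : R i = root_of x i.
  by rewrite /R RR // (nth_map i) ?size_enum_ord // nth_ord_enum.
have C_le i : i < k -> C i <= p by move=> ik; rewrite (CE (Ordinal ik)) ltnW.
have R_le i : i < k -> R i <= n by move=> ik; rewrite (RE (Ordinal ik)) ltnW.
have index_lt q (u v : 'I_q) : u * q + v < q * q.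
  by apply: leq_trans (_ : u.+1 * q <= _); rewrite ?leq_mul2r ?ltn_ord ?orbT // mulSn addnC ltn_add2r.
have HE (u v : 'I_n) : H (u * n + v) = ((u, v) \in arcs (host x)).
  by rewrite /H HH // nth_arcs_code.
have AE (u v : 'I_p) : A (u * p + v) = ((u, v) \in arcs (pat x)).
  by rewrite /A AA // nth_arcs_code.
have adjE (w : 'I_p) (v : 'I_n) : adj n p k H A C R w v = compatible w v.
  apply: eq_forallb => i; rewrite CE RE !HE !AE.
  by rewrite !lt0b.
have I2 : state_inv n p k H A C R 0 s2.1.1.
  split=> //.
  (* Initially nothing is owned and all prices are 0, so the auction invariants hold trivially. *)
  by apply: (eq_auction (fsym own0) (fsym price0)); split.
have [s3_out I3 Cl] := run_match_all C_le R_le I2 erefl.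
rewrite -/s3 in s3_out I3 Cl; have [T3 Au3 F3] := I3.
have -> : run solve (params n p k, drop 3 (encode x), [::]) = run output s3.
  by rewrite /s3 /s2 /s1 /solve !run_Seq.
rewrite (run_output T3) ?s3_out //; last by move=> v; apply: auction_own Au3 _.
set own := s3.1.1 aown.+1 in Au3 Cl *.
case: posnP => [nofail|fail]; [left | right].
- have matched w : w < p -> exists2 v, v < n & own v = w.+1.
    by move=> /Cl []; rewrite ?nofail.
  have [phi phiE phi_adj] := auction_done Au3 matched.
  have phi_inj : injective phi.
    move=> w w' E; have := phiE w (phi w); rewrite eqxx => /eqP own_w.
    by have := phiE w' (phi w); rewrite E eqxx -E own_w => /eqP[] /val_inj.
  exists (image_digraph phi (pat x)); split.
    by apply: compatible_is_solution => // w; rewrite -adjE.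
  (* Host vertices are either unowned and outside the image of [phi], or the image of their owner;
     this settles each printed entry. *)
  have ownP (v : 'I_n) : (own v = 0 /\ forall w, v != phi w) \/
                         exists w : 'I_p, own v = w.+1 /\ v = phi w.
    case ov: (own v) => [|w]; [left | right].
      by split=> // w; rewrite -phiE ov.
    have wp : w < p by rewrite -ov; apply: auction_own Au3 _ (ltn_ord v).
    by exists (Ordinal wp); split=> //; apply/eqP; rewrite -phiE ov.
  congr (1 :: _ ++ _); apply/esym.
    apply: map_enum_ord => v; have [[-> ne]|[w [-> ->]]] := ownP v.
      by rewrite ltnn; case: imsetP => // -[w _ /eqP]; rewrite (negPf (ne w)).
    by rewrite imset_f // pat_verts inE.
  congr flatten; apply: map_enum_ord => u; apply: map_enum_ord => v.
  have notin (e : 'I_n * 'I_n) : (forall w, e.1 != phi w) \/ (forall w, e.2 != phi w) ->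
      (e \in arcs (image_digraph phi (pat x))) = false.
    move=> ne; apply/imsetP => -[[a b] _ E]; rewrite E /= in ne.
    by case: ne => [/(_ a)|/(_ b)]; rewrite eqxx.
  rewrite /out_arc; have [[-> ne]|[w [-> Eu]]] := ownP u.
    by rewrite notin //; left.
  have [[-> ne]|[w' [-> Ev]]] := ownP v.
    by rewrite notin //; right.
  by rewrite /= !subn1 AE Eu Ev image_arc.
- split=> // -[H' /solution_compatible [phi phi_inj phiC]].
  by case: (F3 fail); exists phi => // w; rewrite adjE.
Qed.

Theorem mainTheorem3 : fpt encode nstars correct_output.
Proof.
have [P [D HP]] := run_cmd_poly solve.
(* The algorithm is polynomial, so the constant 1 serves as g; a two-instruction program computes
   it. *)
exists P, (fun=> 1), D; split.
  by exists [:: Const 0 1; Print 0] => k; exists 2.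
move=> x; set N := size (encode x).
have encE : encode x = [:: host_size x, pat_size x, nstars x & drop 3 (encode x)].
  by rewrite /encode /= drop0.
(* The adjacency matrices and the lists of centers and roots make the encoding longer than each of
   the three parameters. *)
have sizeN : N = 3 + (host_size x * host_size x + (pat_size x * pat_size x
    + (nstars x + (host_size x + nstars x)))).
  by rewrite /N /encode /set_code !size_cat !size_arcs_code !(size_enum_ord, size_map).
have [||||t tN Pt] := HP (host_size x) (pat_size x) (nstars x) (drop 3 (encode x)) N;
  try by rewrite sizeN; nia.
exists t, (run solve (params (host_size x) (pat_size x) (nstars x),
                      drop 3 (encode x), [::])).2.
split; [by rewrite {1}encE | by rewrite mul1n | exact: run_solve].
Qed.
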